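(* Unweighted $d$-Scattered Set can be solved in time $O^*(2^{O(\mathrm{td}^2)})$, where $\mathrm{td}$ is the tree-depth of the input graph.
   Context: Unweighted $d$-Scattered Set: given a graph $G=(V,E)$ and integers $d,k$, decide whether there is $K\subseteq V$ with $|K|\ge k$ such that the (unweighted) shortest-path distance between every two distinct vertices of $K$ is at least $d$. The tree-depth of a graph is the minimum height of a rooted forest whose completion (the graph obtained by joining every node to all its ancestors) contains the graph as a subgraph. $O^*(\cdot)$ hides factors polynomial in the input size. *)

(* Defs.v *)
From mathcomp Require Import all_boot all_order all_algebra boolp.

Set Implicit Arguments.
Unset Strict Implicit.
Unset Printing Implicit Defensive.

(** ** Graphs and distances *)

Record graph := Graph {
  order : nat;
  adj : rel 'I_order;
  adj_sym : symmetric adj;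
  adj_irrefl : irreflexive adj }.

Section Distance.
Variables (T : finType) (e : rel T).
Implicit Types u v : T.

Definition walk_of_length u v (n : nat) : bool :=
  [exists p : n.-tuple T, path e u p && (last u p == v)].

Lemma connect_walk u v : connect e u v -> exists n, walk_of_length u v n.
Proof.
case/connectP=> p ep ->; exists (size p); apply/existsP.
by exists (in_tuple p); rewrite /= ep eqxx.
Qed.

(** [None] is the infinite distance between different components. *)
Definition dist u v : option nat :=
  if @idP (connect e u v) is ReflectT uv then Some (ex_minn (connect_walk uv))
  else None.

Definition dist_at_least (d : int) u v : bool :=
  if dist u v is Some m then (d <= m%:Z)%R else true.

Definition scattered (d : int) (K : {set T}) : bool :=
  [forall u in K, forall v in K, (u != v) ==> dist_at_least d u v].

End Distance.

Definition has_scattered_set (G : graph) (d k : int) : bool :=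
  [exists K : {set 'I_(order G)}, (k <= #|K|%:Z)%R && scattered (@adj G) d K].

(** ** Tree-depth *)

Record rooted_forest := RootedForest {
  node :> finType;
  parent : node -> option node;
  parent_wf : forall x, exists n, iter n (obind parent) (Some x) == None }.

Section Forest.
Variable F : rooted_forest.
Implicit Types x y : F.

(** The number of nodes, both ends included, on the path from [x] to its
    root; so a forest with a single node has height 1. *)
Definition depth x : nat := ex_minn (parent_wf x).

Definition height : nat := \max_(x : F) depth x.

(** Reflexive. *)
Definition ancestor x y : bool :=
  connect [rel z t | parent z == Some t] y x.

Definition completion : rel F :=
  [rel x y | (x != y) && (ancestor x y || ancestor y x)].

End Forest.

(** The forest may have more nodes than the graph has vertices. *)
Definition subgraph_of_completion (G : graph) (F : rooted_forest) : Prop :=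
  exists2 f : 'I_(order G) -> F,
    injective f & forall x y, adj x y -> completion (f x) (f y).

Definition td_witness (G : graph) (h : nat) : Prop :=
  exists2 F : rooted_forest, height F = h & subgraph_of_completion G F.

(** A path, rooted at vertex 0, whose completion is complete. *)
Section PathForest.
Variable n : nat.

Definition path_parent (i : 'I_n) : option 'I_n :=
  if 0 < i then insub i.-1 else None.

Lemma path_parent_wf i : exists m, iter m (obind path_parent) (Some i) == None.
Proof.
case: i => i; elim: i => [|i IH] lt_i_n; first by exists 1.
have [m Hm] := IH (ltnW lt_i_n); exists m.+1.
by rewrite iterSr /= {2}/path_parent /= (insubT (fun k => k < n) (ltnW lt_i_n)).
Qed.

Definition path_forest := RootedForest path_parent_wf.

Lemma path_ancestor (i j : path_forest) : val i <= val j -> ancestor i j.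
Proof.
case: j => j /=; elim: j => [|j IH] lt_j_n.
  by rewrite leqn0 => /eqP i0; rewrite /ancestor (_ : Ordinal _ = i) //; apply: val_inj.
rewrite leq_eqVlt => /orP[/eqP ij | le_ij].
  by rewrite /ancestor (_ : Ordinal _ = i) //; apply: val_inj.
apply: connect_trans (IH (ltnW lt_j_n) le_ij); apply: connect1.
by rewrite /= /path_parent /= (insubT (fun k => k < n) (ltnW lt_j_n)).
Qed.

End PathForest.

Lemma td_witness_exists (G : graph) : exists h, `[< td_witness G h >].
Proof.
exists (height (path_forest (order G))); apply/asboolP.
exists (path_forest (order G)) => //; exists id => // x y xy.
apply/andP; split; first by apply: contraTneq xy => ->; rewrite adj_irrefl.
by case/orP: (leq_total (val x) (val y)) => /path_ancestor ->; rewrite ?orbT.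
Qed.

Definition treedepth (G : graph) : nat := ex_minn (td_witness_exists G).

(** ** Running time

    Algorithms are programs of a first-order LISP-like language over binary
    trees (similar to the languages F and WHILE of Neil Jones, "Computability
    and Complexity from a Programming Perspective"). A tree is only built by
    pairing and only inspected at its root, so each evaluation step is a
    bounded amount of pointer manipulation on shared trees, and running time
    is polynomially related to time on Turing machines or RAMs. Bounds of the
    form [poly * 2 ^ O(td ^ 2)] are stable under such changes of model. *)

Inductive tree := Nil | Cons (a b : tree).

Fixpoint tree_size (x : tree) : nat :=
  if x is Cons a b then (tree_size a + tree_size b).+1 else 1.

(** Variables are de Bruijn indices. [Case e e0 e1] evaluates [e0] if [e] is
    [Nil] and otherwise [e1] with the left and right subtrees as variables 0
    and 1. [Let e e1] binds variable 0 in [e1]. *)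
Inductive expr :=
| Var of nat
| ENil
| ECons of expr & expr
| Case of expr & expr & expr
| Let of expr & expr
| Call of nat & expr.

(** The list of the bodies of mutually recursive unary functions, the argument
    being variable 0; function 0 is the entry point. *)
Definition program := seq expr.

Inductive eval (P : program) : seq tree -> expr -> tree -> nat -> Prop :=
| EvalVar env i : eval P env (Var i) (nth Nil env i) 1
| EvalNil env : eval P env ENil Nil 1
| EvalCons env e1 e2 a b t1 t2 :
    eval P env e1 a t1 -> eval P env e2 b t2 ->
    eval P env (ECons e1 e2) (Cons a b) (t1 + t2).+1
| EvalCaseNil env e e0 e1 v t1 t2 :
    eval P env e Nil t1 -> eval P env e0 v t2 ->
    eval P env (Case e e0 e1) v (t1 + t2).+1
| EvalCaseCons env e e0 e1 a b v t1 t2 :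
    eval P env e (Cons a b) t1 -> eval P [:: a, b & env] e1 v t2 ->
    eval P env (Case e e0 e1) v (t1 + t2).+1
| EvalLet env e e1 a v t1 t2 :
    eval P env e a t1 -> eval P (a :: env) e1 v t2 ->
    eval P env (Let e e1) v (t1 + t2).+1
| EvalCall env f e a v t1 t2 :
    eval P env e a t1 -> eval P [:: a] (nth ENil P f) v t2 ->
    eval P env (Call f e) v (t1 + t2).+1.

Definition runs (P : program) (input output : tree) (time : nat) : Prop :=
  eval P [:: input] (nth ENil P 0) output time.

Lemma eval_deterministic P env e v1 t1 v2 t2 :
  eval P env e v1 t1 -> eval P env e v2 t2 -> v1 = v2 /\ t1 = t2.
Proof.
have consI a b a' b' : Cons a b = Cons a' b' -> a = a' /\ b = b' by case.
move=> ev1; elim: ev1 v2 t2 => {env e v1 t1} *;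
match goal with H : eval _ _ _ ?v ?t |- _ = ?v /\ _ = ?t =>
  inversion H; subst; clear H end;
repeat match goal with
| IH : forall v t, eval _ _ ?e v t -> _, H : eval _ _ ?e _ _ |- _ =>
  let E := fresh in
  have [E ?] := IH _ _ H; clear IH; try discriminate E;
  try (apply consI in E as [? ?]); subst
end; by [].
Qed.

(** ** Encoding of instances *)

Definition enc_bool (b : bool) : tree := if b then Cons Nil Nil else Nil.

Definition enc_list (s : seq tree) : tree := foldr Cons Nil s.

(** Binary digits, least significant first; [0] has the single digit 0. *)
Definition bits (n : nat) : seq bool :=
  mkseq (fun i => odd (n %/ 2 ^ i)) (trunc_log 2 n).+1.

Definition enc_nat (n : nat) : tree := enc_list (map enc_bool (bits n)).

Definition enc_int (z : int) : tree :=
  Cons (enc_bool (z < 0)%R) (enc_nat `|z|%N).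

(** The rows of the adjacency matrix. *)
Definition enc_graph (G : graph) : tree :=
  enc_list [seq enc_list [seq enc_bool (adj i j) | j <- enum 'I_(order G)]
           | i <- enum 'I_(order G)].

Definition enc_instance (G : graph) (d k : int) : tree :=
  Cons (enc_graph G) (Cons (enc_int d) (enc_int k)).

(* Main.v *)
From mathcomp Require Import all_boot all_order all_algebra zify boolp.
Require Import Defs.

(** A graph of tree-depth [h] has fewer than [2 ^ h] vertices on every path, so
    finite distances are smaller than [2 ^ h] and [d] may be capped at [2 ^ h].

    An elimination order of width [O(h)] is found top-down. Given the set [X] of
    vertices chosen so far, take a component [C] of [G - X] with neighbourhood
    [W], and choose a set [S] of at most [h] vertices such that no component of
    [G[C + W] - S] contains more than half of [W]; the ancestors of a suitable
    node of an optimal forest show that [S] exists. To find it, branch over the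
    elements of a minimal subset of what is left that is still unbalanced: it
    must meet [S], and it is contained in a union of at most [|W|] paths, so it
    has at most [|W| 2 ^ h] elements. This takes [2 ^ O(h ^ 2)] branches.

    Dynamic programming along the order stores, for every connected piece [C] of
    the eliminated part, the pairs (distances from [K] to the neighbours of [C],
    [|K|]) over the scattered subsets [K] of [C]. As the neighbours separate [C]
    from the rest, distances between pieces are determined by these profiles,
    of which there are at most [(2 ^ h + 1) ^ O(h)].

    Programs are obtained from a class of functions, closed under composition
    and [foldl], whose time and output size are polynomial in the sizes of the
    intermediate values; thus only the latter have to be bounded. *)

Set Implicit Arguments.
Unset Strict Implicit.
Unset Printing Implicit Defensive.

(** The program never learns [h]: the separator search stops at the first size that succeeds, and
    the distance cap is read off the graph. Tree-depth enters only the analysis, through the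
    ancestor order of an optimal forest.

    The constants come from a fixed point. A new component sees at most [h + 1] vertices chosen just
    now and half of at most [2h + 2] old ones, so [2h + 2] is preserved; halving the neighbourhood,
    not the component, is what prevents growth. A batch of [h + 1] vertices is eliminated one by
    one, and meanwhile the width may rise to [3h + 3]. Both exponents are then quadratic: [h] levels
    of branching over [O(h) 2 ^ h] elements, and [3h + 4] coordinates with [2 ^ h + 1] values.

    The obstacle on the timing side is that a round of an outer loop has no good bound on arbitrary
    arguments: its inner lists are short only under the invariants of the run. Hence costs are
    polynomial in the size of the argument and in a measure [m] of it. The measure of a round adds
    up the sizes of its intermediate values and is bounded only afterwards, along the actual run. *)

(** * Encodings of data as trees, and their sizes *)

Class Enc (A : Type) := enc : A -> tree.

#[global] Instance enc_of_bool : Enc bool := enc_bool.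
#[global] Instance enc_of_unit : Enc unit := fun=> Nil.
(** Unary, so that arithmetic is list manipulation and a loop can run over a number. This is
    affordable because the numbers handled by the algorithm stay linear in the number of
    vertices. *)
#[global] Instance enc_of_nat : Enc nat := fun n => enc_list (nseq n Nil).
#[global] Instance enc_of_pair A B (EA : Enc A) (EB : Enc B) : Enc (A * B) :=
  fun x => Cons (enc x.1) (enc x.2).
#[global] Instance enc_of_seq A (EA : Enc A) : Enc (seq A) :=
  fun s => enc_list (map enc s).

Definition esize {A} {EA : Enc A} (x : A) := tree_size (enc x).

Lemma esize_gt0 A (EA : Enc A) (x : A) : 0 < esize x.
Proof. by rewrite /esize; case: (enc x). Qed.

Lemma esize_seq_gt0 A (EA : Enc A) (s : seq A) : 0 < esize s.
Proof. exact: esize_gt0. Qed.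

Lemma esize_pair A B (EA : Enc A) (EB : Enc B) (x : A) (y : B) :
  esize (x, y) = (esize x + esize y).+1.
Proof. by []. Qed.

Lemma esize_cons A (EA : Enc A) (x : A) (s : seq A) :
  esize (x :: s) = (esize x + esize s).+1.
Proof. by []. Qed.

Lemma esize_nat (n : nat) : esize n = n.*2.+1.
Proof. by rewrite /esize; elim: n => //= n; rewrite /enc /enc_of_nat /= => ->; lia. Qed.

Lemma esize_bool (b : bool) : esize b <= 3.
Proof. by case: b. Qed.

Lemma esize_cat A (EA : Enc A) (s t : seq A) :
  (esize (s ++ t)).+1 = esize s + esize t.
Proof. by elim: s => [|x s IH] //=; rewrite !esize_cons; lia. Qed.

Lemma esize_rcons A (EA : Enc A) (s : seq A) x :
  esize (rcons s x) = (esize x + esize s).+1.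
Proof. by elim: s => [|y s IH] //=; rewrite !esize_cons IH; lia. Qed.

Lemma size_esize A (EA : Enc A) (s : seq A) : size s < esize s.
Proof. by elim: s => [|x s IH] //=; rewrite esize_cons; lia. Qed.

Lemma esize_rev A (EA : Enc A) (s : seq A) : esize (rev s) = esize s.
Proof. by elim: s => [|x s IH] //=; rewrite rev_cons esize_rcons IH. Qed.

Lemma esize_subseq A (EA : Enc A) (s : seq A) p : esize (filter p s) <= esize s.
Proof. by elim: s => [|x s IH] //=; case: (p x); rewrite !esize_cons; lia. Qed.

(** Splittings of the list replace membership because [A] carries no decidable equality. *)
Lemma esize_seq_le A (EA : Enc A) (s : seq A) k :
  (forall l1 x l2, s = l1 ++ x :: l2 -> esize x <= k) ->
  esize s <= (size s * k.+1).+1.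
Proof.
elim: s => [|x s IH] // H; rewrite esize_cons /=.
have := H [::] x s erefl; have: esize s <= (size s * k.+1).+1.
  by apply: IH => l1 y l2 E; apply: (H (x :: l1) y l2); rewrite E.
by lia.
Qed.

(** * Polynomially bounded families *)

(** At least 2, because sizes are positive; so constants and factors are absorbed by raising the
    exponent, and powers of [scale] serve as all polynomial bounds. *)
Definition scale {A} {EA : Enc A} (m : A -> nat) (a : A) := (esize a + m a).+1.

Definition pbound {A} {EA : Enc A} (m b : A -> nat) :=
  exists k, forall a, b a <= scale m a ^ k.

Section PBound.
Context {A : Type} {EA : Enc A}.
Implicit Types m b : A -> nat.

Lemma scale_gt1 m a : 1 < scale m a.
Proof. by have := esize_gt0 EA a; rewrite /scale; lia. Qed.

Lemma scale_gt0 m a : 0 < scale m a.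
Proof. exact: ltnW (scale_gt1 m a). Qed.

Lemma pbound_le m b1 b2 : (forall a, b1 a <= b2 a) -> pbound m b2 -> pbound m b1.
Proof. by move=> le12 [k H]; exists k => a; apply: leq_trans (H a). Qed.

Lemma pbound_const m c : pbound m (fun=> c).
Proof.
by exists c => a; apply: ltnW; apply: ltn_expl; apply: scale_gt1.
Qed.

Lemma pbound_esize m : pbound m esize.
Proof. by exists 1 => a; rewrite expn1 /scale; lia. Qed.

Lemma pbound_id m : pbound m m.
Proof. by exists 1 => a; rewrite expn1 /scale; lia. Qed.

Lemma pbound_mul m b1 b2 :
  pbound m b1 -> pbound m b2 -> pbound m (fun a => b1 a * b2 a).
Proof.
move=> [k1 H1] [k2 H2]; exists (k1 + k2) => a.
by rewrite expnD leq_mul.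
Qed.

Lemma pbound_add m b1 b2 :
  pbound m b1 -> pbound m b2 -> pbound m (fun a => b1 a + b2 a).
Proof.
move=> [k1 H1] [k2 H2]; exists (k1 + k2).+1 => a.
have s0 := scale_gt0 m a; have s1 := scale_gt1 m a.
apply: (@leq_trans (2 * scale m a ^ (k1 + k2))).
  rewrite mul2n -addnn; apply: leq_add.
    by apply: leq_trans (H1 a) _; rewrite leq_pexp2l // leq_addr.
  by apply: leq_trans (H2 a) _; rewrite leq_pexp2l // leq_addl.
by rewrite expnS leq_mul2r s1 orbT.
Qed.

Lemma pbound_succ m b : pbound m b -> pbound m (fun a => (b a).+1).
Proof.
move=> H; apply: (pbound_le (b2 := fun a => b a + 1)) => [a|]; first by rewrite addn1.
by apply: pbound_add => //; apply: pbound_const.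
Qed.

Lemma pbound_exp m b k : pbound m b -> pbound m (fun a => b a ^ k).
Proof.
by move=> [c H]; exists (c * k) => a; rewrite expnM; case: k => // k; rewrite leq_exp2r.
Qed.

End PBound.

Lemma pbound_comp A B (EA : Enc A) (EB : Enc B) (m : A -> nat) (m' b : B -> nat)
    (f : A -> B) :
  pbound m (fun a => esize (f a)) -> pbound m (fun a => m' (f a)) ->
  pbound m' b -> pbound m (fun a => b (f a)).
Proof.
move=> Hf Hm [k Hb]; apply: (pbound_le (b2 := fun a => scale m' (f a) ^ k)) => //.
by apply: pbound_exp; apply: pbound_succ; apply: pbound_add.
Qed.

(** * Computable functions *)

Definition placed (P : program) n Q :=
  forall i, i < size Q -> nth ENil P (n + i) = nth ENil Q i.

(** Quantifying over the position [n] of the auxiliary functions and over the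
    rest of the environment makes composition free of renumbering. *)
Definition computes {A B} {EA : Enc A} {EB : Enc B} (m : A -> nat) (F : A -> B) :=
  exists2 T, pbound m T &
  forall n, exists Q e, forall P env a, placed P n Q -> exists t,
    [/\ eval P (enc a :: env) e (enc (F a)) t, t <= T a & esize (F a) <= T a].

Lemma placed_cat P n Q1 Q2 :
  placed P n (Q1 ++ Q2) -> placed P n Q1 /\ placed P (n + size Q1) Q2.
Proof.
move=> H; split=> i Hi.
  by rewrite H ?size_cat ?nth_cat ?Hi //; lia.
rewrite -addnA H ?size_cat; last by lia.
by rewrite nth_cat ltnNge leq_addr /= addnC addnK.
Qed.

Section Basic.
Context {A : Type} {EA : Enc A}.
Implicit Types m : A -> nat.

Lemma computes_esize B (EB : Enc B) m (F : A -> B) :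
  computes m F -> pbound m (fun a => esize (F a)).
Proof.
move=> [T HT H]; apply: pbound_le HT => a.
have [Q [e He]] := H 0.
have [|t []//] := He Q [::] a.
by move=> i.
Qed.

Lemma computes_eq B (EB : Enc B) m (F G : A -> B) :
  F =1 G -> computes m F -> computes m G.
Proof.
move=> FG [T HT H]; exists T => // n; have [Q [e He]] := H n.
by exists Q, e => P env a /(He P env a); rewrite FG.
Qed.

(** Changing the type is free when the trees coincide. List cells and successors are obtained in
    this way from pairs, and an instance is read as a matrix with two digit lists. *)
Lemma computes_cast B C (EB : Enc B) (EC : Enc C) m (F : A -> B) (G : A -> C) :
  (forall a, enc (F a) = enc (G a)) -> computes m F -> computes m G.
Proof.
move=> FG [T HT H]; exists T => // n; have [Q [e He]] := H n.
by exists Q, e => P env a /(He P env a); rewrite /esize FG.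
Qed.

Lemma computes_id m : computes m (fun a : A => a).
Proof.
exists esize; first exact: pbound_esize.
move=> n; exists [::], (Var 0) => P env a _; exists 1; split=> //; last exact: esize_gt0.
exact: (EvalVar P (enc a :: env) 0).
Qed.

Fixpoint expr_of_tree (x : tree) : expr :=
  if x is Cons a b then ECons (expr_of_tree a) (expr_of_tree b) else ENil.

Lemma eval_expr_of_tree P env x : eval P env (expr_of_tree x) x (tree_size x).
Proof. by elim: x => /= *; constructor. Qed.

Lemma computes_const B (EB : Enc B) m (b : B) : computes m (fun=> b).
Proof.
exists (fun=> esize b); first exact: pbound_const.
move=> n; exists [::], (expr_of_tree (enc b)) => P env a _.
by exists (esize b); split=> //; apply: eval_expr_of_tree.
Qed.

(** The measure of [G] only matters on the values of [F]; this is where invariants of the arguments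
    can be used. *)
Lemma computes_comp B C (EB : Enc B) (EC : Enc C) m (m' : B -> nat)
    (F : A -> B) (G : B -> C) :
  computes m' G -> computes m F -> pbound m (fun a => m' (F a)) ->
  computes m (fun a => G (F a)).
Proof.
move=> [T2 HT2 H2] HF mm'; have sF := computes_esize HF.
case: HF => T1 HT1 H1.
exists (fun a => (T1 a + T2 (F a)).+1).
  by apply: pbound_succ; apply: pbound_add => //; apply: pbound_comp HT2.
move=> n; have [Q1 [e1 He1]] := H1 n; have [Q2 [e2 He2]] := H2 (n + size Q1).
exists (Q1 ++ Q2), (Let e1 e2) => P env a /placed_cat[/He1 h1 /He2 h2].
have [t1 [E1 L1 _]] := h1 env a.
have [t2 [E2 L2 S2]] := h2 (enc a :: env) (F a).
exists (t1 + t2).+1; split; [|lia|lia].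
by apply: EvalLet E1 E2.
Qed.

Lemma computes_pair B C (EB : Enc B) (EC : Enc C) m (F : A -> B) (G : A -> C) :
  computes m F -> computes m G -> computes m (fun a => (F a, G a)).
Proof.
move=> [T1 HT1 H1] [T2 HT2 H2].
exists (fun a => (T1 a + T2 a).+1).
  by apply: pbound_succ; apply: pbound_add.
move=> n; have [Q1 [e1 He1]] := H1 n; have [Q2 [e2 He2]] := H2 (n + size Q1).
exists (Q1 ++ Q2), (ECons e1 e2) => P env a /placed_cat[/He1 h1 /He2 h2].
have [t1 [E1 L1 S1]] := h1 env a; have [t2 [E2 L2 S2]] := h2 env a.
exists (t1 + t2).+1; split; [|lia|by rewrite esize_pair; lia].
exact: EvalCons.
Qed.

Lemma computes_fst B C (EB : Enc B) (EC : Enc C) m (F : A -> B * C) :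
  computes m F -> computes m (fun a => (F a).1).
Proof.
move=> [T HT H]; exists (fun a => (T a).+2); first by do 2!apply: pbound_succ.
move=> n; have [Q [e He]] := H n.
exists Q, (Case e ENil (Var 0)) => P env a /He h.
have [t [E L S]] := h env a; exists (t + 1).+1; split; [|lia|].
  by apply: EvalCaseCons E _; apply: (EvalVar P [:: enc (F a).1, _ & _] 0).
by move: S; case: (F a) => b c; rewrite esize_pair /=; lia.
Qed.

Lemma computes_snd B C (EB : Enc B) (EC : Enc C) m (F : A -> B * C) :
  computes m F -> computes m (fun a => (F a).2).
Proof.
move=> [T HT H]; exists (fun a => (T a).+2); first by do 2!apply: pbound_succ.
move=> n; have [Q [e He]] := H n.
exists Q, (Case e ENil (Var 1)) => P env a /He h.
have [t [E L S]] := h env a; exists (t + 1).+1; split; [|lia|].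
  by apply: EvalCaseCons E _; apply: (EvalVar P [:: _, enc (F a).2 & _] 1).
by move: S; case: (F a) => b c; rewrite esize_pair /=; lia.
Qed.

Lemma computes_cons B (EB : Enc B) m (F : A -> B) (G : A -> seq B) :
  computes m F -> computes m G -> computes m (fun a => F a :: G a).
Proof.
move=> HF HG; apply: (computes_cast (F := fun a => (F a, G a))) => //.
exact: computes_pair.
Qed.

Lemma computes_succ m (F : A -> nat) : computes m F -> computes m (fun a => (F a).+1).
Proof.
move=> HF; apply: (computes_cast (F := fun a => (tt, F a))) => //.
by apply: computes_pair => //; apply: computes_const.
Qed.

Lemma computes_if B (EB : Enc B) m (b : A -> bool) (F G : A -> B) :
  computes m b -> computes m F -> computes m G ->
  computes m (fun a => if b a then F a else G a).
Proof.
move=> [T0 HT0 H0] [T1 HT1 H1] [T2 HT2 H2].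
exists (fun a => (T0 a + T1 a + T2 a).+3).
  by do 3!apply: pbound_succ; do 2?apply: pbound_add.
move=> n; have [Q0 [e0 He0]] := H0 n; have [Q1 [e1 He1]] := H1 (n + size Q0).
have [Q2 [e2 He2]] := H2 (n + size Q0 + size Q1).
(* In the nonempty branch [Case] has bound the two subtrees of the boolean, so the argument has
   become variable 2; [Let] brings it back to 0. *)
exists (Q0 ++ (Q1 ++ Q2)), (Case e0 e2 (Let (Var 2) e1)).
move=> P env a /placed_cat[/He0 h0 /placed_cat[/He1 h1 /He2 h2]].
have [t0 [E0 L0 S0]] := h0 env a.
case: (b a) E0 => E0.
  have [t1 [E1 L1 S1]] := h1 [:: Nil, Nil, enc a & env] a.
  exists (t0 + (1 + t1).+1).+1; split; [|lia|lia].
  apply: EvalCaseCons E0 _; apply: EvalLet E1.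
  exact: (EvalVar P [:: Nil, Nil, enc a & env] 2).
have [t2 [E2 L2 S2]] := h2 env a.
by exists (t0 + t2).+1; split; [exact: EvalCaseNil E0 E2|lia|lia].
Qed.

Lemma computes_case B C (EB : Enc B) (EC : Enc C) m (m' : A * (B * seq B) -> nat) (s : A -> seq B) (F : A -> C)
    (G : A -> B -> seq B -> C) :
  computes m s -> computes m F ->
  computes m' (fun x : A * (B * seq B) => G x.1 x.2.1 x.2.2) ->
  pbound m (fun a => if s a is b :: r then m' (a, (b, r)) else 0) ->
  computes m (fun a => if s a is b :: r then G a b r else F a).
Proof.
move=> Hs [T1 HT1 H1] [T2 HT2 H2] mm'; have ss := computes_esize Hs.
case: Hs => T0 HT0 H0.
exists (fun a => (T0 a + T1 a + if s a is b :: r then T2 (a, (b, r)) else 0) + 9).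
  apply: pbound_add (pbound_const _ _); apply: pbound_add; first exact: pbound_add.
  case: HT2 => k HT2.
  apply: (@pbound_le _ _ _ _ (fun a => (esize a + esize (s a) +
    (if s a is b :: r then m' (a, (b, r)) else 0) + 9) ^ k)) => [a|].
    case: (s a) => [|b r] //; apply: leq_trans (HT2 _) _.
    rewrite /scale !esize_pair esize_cons.
    by case: k {HT2} => // k; rewrite leq_exp2r //; lia.
  by apply: pbound_exp; do ![apply: pbound_add => //]; [apply: pbound_esize|apply: pbound_const].
move=> n; have [Q0 [e0 He0]] := H0 n; have [Q1 [e1 He1]] := H1 (n + size Q0).
have [Q2 [e2 He2]] := H2 (n + size Q0 + size Q1).
exists (Q0 ++ (Q1 ++ Q2)), (Case e0 e1 (Let (ECons (Var 2) (ECons (Var 0) (Var 1))) e2)).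
move=> P env a /placed_cat[/He0 h0 /placed_cat[/He1 h1 /He2 h2]].
have [t0 [E0 L0 S0]] := h0 env a.
case: (s a) E0 => [|b r] E0.
  have [t1 [E1 L1 S1]] := h1 env a.
  by exists (t0 + t1).+1; split; [exact: EvalCaseNil E0 E1|lia|lia].
have /= [t2 [E2 L2 S2]] := h2 [:: enc b, enc r, enc a & env] (a, (b, r)).
exists (t0 + ((1 + (1 + 1).+1).+1 + t2).+1).+1; split; [|lia|lia].
apply: EvalCaseCons E0 _; apply: EvalLet E2.
set env' := _ :: _.
apply: EvalCons (EvalVar P env' 2) _.
exact: EvalCons (EvalVar P env' 0) (EvalVar P env' 1).
Qed.

(** The argument is [(a, (s, l))]; [step] is run on [(a, s, b)] for the head [b] of [l]. *)
Definition fold_body self step :=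
  Case (Var 0) ENil (Case (Var 1) ENil (Case (Var 1) (Var 0)
    (Call self (ECons (Var 4) (ECons
      (Let (ECons (ECons (Var 4) (Var 2)) (Var 0)) step) (Var 1)))))).

(** The step is evaluated below the variables bound by three nested [Case]s, hence the
    quantification over [env]; it is only required to be fast on accumulators that this fold
    reaches. The constant 20 pays for the bookkeeping of a round. *)
Lemma eval_fold_body B S (EB : Enc B) (ES : Enc S) P self step (f : A -> S -> B -> S) k :
  nth ENil P self = fold_body self step ->
  forall a s l,
  (forall env l1 b l2, l = l1 ++ b :: l2 -> exists t,
     eval P (enc (a, foldl (f a) s l1, b) :: env) step
       (enc (f a (foldl (f a) s l1) b)) t /\ t <= k) ->
  exists t, eval P [:: enc (a, (s, l))] (fold_body self step)
    (enc (foldl (f a) s l)) t /\ t <= (size l).+1 * (k + 20).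
Proof.
move=> HP a s l; elim: l s => [|b l IH] s H.
  exists (1 + (1 + (1 + 1).+1).+1).+1; split; last by lia.
  apply: EvalCaseCons; first exact: (EvalVar _ [:: _] 0).
  apply: EvalCaseCons; first exact: (EvalVar _ [:: _; _; _] 1).
  apply: EvalCaseNil; first exact: (EvalVar _ [:: _; _; _; _; _] 1).
  exact: (EvalVar _ [:: _; _; _; _; _] 0).
have [|t [E1 L1]] := IH (f a s b).
  move=> env l1 c l2 E; have [|t Ht] := H env (b :: l1) c l2; first by rewrite E.
  by exists t.
set env' := [:: enc b; enc l; enc s; enc l; enc a; enc (s, b :: l); enc (a, (s, b :: l))].
have [|t' [E2 L2]] := H [:: enc b, enc l & [:: enc s; enc (b :: l); enc a; enc (s, b :: l); enc (a, (s, b :: l))]] [::] b l; first by [].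
eexists; split.
  apply: EvalCaseCons; first exact: (EvalVar _ [:: _] 0).
  apply: EvalCaseCons; first exact: (EvalVar _ [:: _; _; _] 1).
  apply: EvalCaseCons; first exact: (EvalVar _ [:: _; _; _; _; _] 1).
  apply: EvalCall; last by rewrite HP; exact: E1.
  apply: EvalCons; first exact: (EvalVar _ [:: _; _; _; _; _; _; _] 4).
  apply: EvalCons; last exact: (EvalVar _ [:: _; _; _; _; _; _; _] 1).
  apply: EvalLet; last exact: E2.
  apply: EvalCons; last exact: (EvalVar _ [:: _; _; _; _; _; _; _] 0).
  apply: EvalCons; first exact: (EvalVar _ [:: _; _; _; _; _; _; _] 4).
  exact: (EvalVar _ [:: _; _; _; _; _; _; _] 2).
by rewrite /= mulSn; lia.
Qed.

(** A polynomial step may square its accumulator, so iterating it can leave the class. Therefore the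
    size of the accumulator and the measure of the step are bounded by hypothesis, but only for
    accumulators reached after a prefix of the list. *)
Lemma computes_foldl B S (EB : Enc B) (ES : Enc S) m (m' : A * S * B -> nat) (l : A -> seq B) (s0 : A -> S)
    (f : A -> S -> B -> S) :
  computes m l -> computes m s0 ->
  computes m' (fun x : A * S * B => f x.1.1 x.1.2 x.2) ->
  (exists2 b, pbound m b & forall a l1 l2, l a = l1 ++ l2 ->
     esize (foldl (f a) (s0 a) l1) <= b a) ->
  (exists2 b, pbound m b & forall a l1 x l2, l a = l1 ++ x :: l2 ->
     m' (a, foldl (f a) (s0 a) l1, x) <= b a) ->
  computes m (fun a => foldl (f a) (s0 a) (l a)).
Proof.
move=> Hl Hs Hf [b1 Hb1 Hsize] [b2 Hb2 Hcost].
have szl := computes_esize Hl.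
case: Hl Hs Hf => [T0 HT0 H0] [T1 HT1 H1] [T2 HT2 H2].
have [T' HT' HT2'] : exists2 T', pbound m T' &
    forall a l1 x l2, l a = l1 ++ x :: l2 ->
    T2 (a, foldl (f a) (s0 a) l1, x) <= T' a.
  case: HT2 => k HT2.
  exists (fun a => (esize a + b1 a + esize (l a) + b2 a + 9) ^ k).
    apply: pbound_exp; do ![apply: pbound_add => //]; first exact: pbound_esize.
    exact: pbound_const.
  move=> a l1 x l2 E; apply: leq_trans (HT2 _) _.
  have := Hsize a l1 (x :: l2) E; have := Hcost a l1 x l2 E.
  have : esize x <= esize (l a) by rewrite E; elim: (l1) => [|y l1' IH] /=; rewrite esize_cons; lia.
  move=> ? ? ?; rewrite /scale !esize_pair.
  by case: k {HT2} => // k; rewrite leq_exp2r //; lia.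
exists (fun a => T0 a + T1 a + b1 a + (esize (l a)) * (T' a + 20) + 9).
  apply: pbound_add (pbound_const _ _); apply: pbound_add.
    by do ![apply: pbound_add => //].
  by apply: pbound_mul => //; apply: pbound_add => //; apply: pbound_const.
move=> n; have [Q0 [e0 He0]] := H0 n; have [Q1 [e1 He1]] := H1 (n + size Q0).
have [Q2 [e2 He2]] := H2 (n + size Q0 + size Q1).
set self := n + size Q0 + size Q1 + size Q2.
exists (Q0 ++ (Q1 ++ (Q2 ++ [:: fold_body self e2]))).
exists (Call self (ECons (Var 0) (ECons e1 e0))).
move=> P env a /placed_cat[/He0 h0 /placed_cat[/He1 h1 /placed_cat[/He2 h2]]].
move/(_ 0 isT); rewrite addn0 -/self => HP.
have [t0 [E0 L0 S0]] := h0 env a; have [t1 [E1 L1 S1]] := h1 env a.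
have [t [E L]] : exists t, eval P [:: enc (a, (s0 a, l a))] (fold_body self e2)
    (enc (foldl (f a) (s0 a) (l a))) t /\ t <= (size (l a)).+1 * (T' a + 20).
  apply: eval_fold_body HP _ _ _ _ => env' l1 b l2 El.
  have [t [E L _]] := h2 env' (a, foldl (f a) (s0 a) l1, b).
  by exists t; split=> //; apply: leq_trans L (HT2' _ _ _ _ El).
exists ((1 + (t1 + t0).+1).+1 + t).+1; split.
- apply: EvalCall; last by rewrite HP; exact: E.
  apply: EvalCons; first exact: (EvalVar _ (_ :: _) 0).
  exact: EvalCons.
- have := size_esize EB (l a); move: L; set X := T' a + 20 => L h.
  have: (size (l a)).+1 * X <= esize (l a) * X by rewrite leq_mul2r h orbT.
  by lia.
- have := Hsize a (l a) [::]; rewrite cats0 => /(_ erefl); lia.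
Qed.

End Basic.

(** * Library functions *)

Section Context.
Context {A : Type} {EA : Enc A}.
Implicit Types m : A -> nat.

(** Weakening: values of the outer argument stay available under the binder of a [map], [filter] or
    [has]. *)
Lemma computes_ctx B C (EB : Enc B) (EC : Enc C) m (F : A -> C) :
  computes m F -> computes (fun x : A * B => m x.1) (fun x => F x.1).
Proof.
move=> HF; apply: (computes_comp HF); last exact: pbound_id.
exact/computes_fst/computes_id.
Qed.

Lemma pbound_elem B (EB : Enc B) m (s : A -> seq B) g :
  pbound m (fun a => esize (s a)) -> pbound (fun x : A * B => m x.1) g ->
  exists2 b, pbound m b &
  forall a l1 x l2, s a = l1 ++ x :: l2 -> g (a, x) <= b a.
Proof.
move=> Hs [k Hg]; exists (fun a => (esize a + esize (s a) + m a + 2) ^ k).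
  apply: pbound_exp; do ![apply: pbound_add => //];
    [exact: pbound_esize|exact: pbound_id|exact: pbound_const].
move=> a l1 x l2 E; apply: leq_trans (Hg _) _; rewrite /scale esize_pair /=.
have : esize x <= esize (s a) by rewrite E; elim: (l1) => [|y l1' IH] /=; rewrite esize_cons; lia.
by case: k {Hg} => // k; rewrite leq_exp2r //; lia.
Qed.

Lemma computes_fold B S (EB : Enc B) (ES : Enc S) m (l : A -> seq B) (s0 : A -> S)
    (f : A -> S -> B -> S) :
  computes m l -> computes m s0 ->
  computes (fun x : A * S * B => m x.1.1) (fun x => f x.1.1 x.1.2 x.2) ->
  (exists2 b, pbound m b & forall a l1 l2, l a = l1 ++ l2 ->
     esize (foldl (f a) (s0 a) l1) <= b a) ->
  computes m (fun a => foldl (f a) (s0 a) (l a)).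
Proof.
move=> Hl Hs Hf Hb; apply: (computes_foldl Hl Hs Hf Hb).
by exists m; first exact: pbound_id.
Qed.

Lemma computes_rev B (EB : Enc B) m (s : A -> seq B) :
  computes m s -> computes m (fun a => rev (s a)).
Proof.
move=> Hs; apply: (computes_eq (F := fun a => foldl (fun r x => x :: r) [::] (s a))).
  by move=> a; rewrite -[RHS]cats0 -catrevE; elim: (s a) [::] => //=.
apply: computes_fold => //; first exact: computes_const.
  apply: computes_cons; first exact/computes_snd/computes_id.
  exact/computes_snd/computes_fst/computes_id.
exists (fun a => esize (s a)); first exact: computes_esize.
move=> a l1 l2 ->; rewrite (_ : foldl _ _ _ = rev l1).
  by rewrite esize_rev; elim: l1 => [|x l1 IH] /=; rewrite ?esize_gt0 // !esize_cons; lia.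
by rewrite -[RHS]cats0 -catrevE; elim: l1 [::] => //=.
Qed.

Lemma computes_map B C (EB : Enc B) (EC : Enc C) m (s : A -> seq B) (f : A -> B -> C) :
  computes (fun x : A * B => m x.1) (fun x => f x.1 x.2) -> computes m s ->
  computes m (fun a => map (f a) (s a)).
Proof.
move=> Hf Hs.
have fmap a l : foldl (fun r x => f a x :: r) [::] l = rev (map (f a) l).
  by rewrite -[RHS]cats0 -catrevE; elim: l [::] => //=.
apply: (computes_eq (F := fun a => rev (foldl (fun r x => f a x :: r) [::] (s a)))).
  by move=> a; rewrite fmap revK.
apply: computes_rev; apply: computes_fold => //; first exact: computes_const.
  apply: computes_cons; last exact/computes_snd/computes_fst/computes_id.
  apply: (computes_comp (F := fun x : A * seq C * B => (x.1.1, x.2)) Hf); last exact: pbound_id.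
  by apply: computes_pair; [exact/computes_fst/computes_fst/computes_id|exact/computes_snd/computes_id].
have [b Hb Hfb] := pbound_elem (computes_esize Hs) (computes_esize Hf).
exists (fun a => (esize (s a) * (b a).+1).+1).
  apply: pbound_succ; apply: pbound_mul; first exact: computes_esize.
  exact: pbound_succ.
move=> a l1 l2 E; rewrite fmap esize_rev.
apply: (@leq_trans (size l1 * (b a).+1).+1).
  rewrite -[size l1](size_map (f a)); apply: esize_seq_le => u1 y u2 Eu.
  have /(congr1 (nth y ^~ (size u1))) := Eu.
  have lt: size u1 < size l1 by rewrite -(size_map (f a)) Eu size_cat /=; lia.
  have [x0 _] : exists x0 : B, True by case: (l1) lt => // x0 *; exists x0.
  rewrite (nth_map x0) // nth_cat ltnn subnn /= => <-.
  apply: (Hfb a (take (size u1) l1) _ (drop (size u1).+1 l1 ++ l2)).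
  by rewrite E -{1}(cat_take_drop (size u1) l1) (drop_nth x0) // -catA.
have := size_esize EB (s a); rewrite E size_cat => h.
by rewrite ltnS leq_mul2r /=; lia.
Qed.

Lemma computes_filter B (EB : Enc B) m (s : A -> seq B) (p : A -> B -> bool) :
  computes (fun x : A * B => m x.1) (fun x => p x.1 x.2) -> computes m s ->
  computes m (fun a => filter (p a) (s a)).
Proof.
move=> Hf Hs.
have ff a l : foldl (fun r x => if p a x then x :: r else r) [::] l = rev (filter (p a) l).
  by rewrite -[RHS]cats0 -catrevE; elim: l [::] => //= x l IH r; case: ifP => _; rewrite IH.
apply: (computes_eq
  (F := fun a => rev (foldl (fun r x => if p a x then x :: r else r) [::] (s a)))).
  by move=> a; rewrite ff revK.
apply: computes_rev; apply: computes_fold => //; first exact: computes_const.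
  apply: computes_if; last exact/computes_snd/computes_fst/computes_id.
    apply: (computes_comp (F := fun x : A * seq B * B => (x.1.1, x.2)) Hf); last exact: pbound_id.
    by apply: computes_pair; [exact/computes_fst/computes_fst/computes_id|exact/computes_snd/computes_id].
  apply: computes_cons; first exact/computes_snd/computes_id.
  exact/computes_snd/computes_fst/computes_id.
exists (fun a => esize (s a)); first exact: computes_esize.
move=> a l1 l2 ->; rewrite ff esize_rev; apply: leq_trans (esize_subseq EB _ _) _.
by have := esize_cat EB l1 l2; have := esize_seq_gt0 EB l2; lia.
Qed.

Lemma computes_has B (EB : Enc B) m (s : A -> seq B) (p : A -> B -> bool) :
  computes (fun x : A * B => m x.1) (fun x => p x.1 x.2) -> computes m s ->
  computes m (fun a => has (p a) (s a)).
Proof.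
move=> Hp Hs.
apply: (computes_eq (F := fun a => if filter (p a) (s a) is _ :: _ then true else false)).
  by move=> a /=; elim: (s a) => //= x r <-; case: (p a x).
apply: (computes_case (m' := fun x => m x.1)); last 1 first.
- by apply: pbound_le (pbound_id _) => a; case: filter.
- exact: computes_filter.
- exact: computes_const.
- exact: computes_const.
Qed.

Lemma computes_neg m (b : A -> bool) : computes m b -> computes m (fun a => ~~ b a).
Proof.
move=> H; apply: (computes_eq (F := fun a => if b a then false else true)).
  by move=> a; case: (b a).
by apply: computes_if => //; apply: computes_const.
Qed.

Lemma computes_and m (b c : A -> bool) :
  computes m b -> computes m c -> computes m (fun a => b a && c a).
Proof. by move=> Hb Hc; apply: computes_if => //; apply: computes_const. Qed.

Lemma computes_or m (b c : A -> bool) :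
  computes m b -> computes m c -> computes m (fun a => b a || c a).
Proof. by move=> Hb Hc; apply: computes_if => //; apply: computes_const. Qed.

End Context.

Section Context.
Context {A : Type} {EA : Enc A}.
Implicit Types m : A -> nat.

(** The section was reopened because negation is used here at the argument type [A * B]; the later
    reopenings have the same purpose. *)
Lemma computes_all B (EB : Enc B) m (s : A -> seq B) (p : A -> B -> bool) :
  computes (fun x : A * B => m x.1) (fun x => p x.1 x.2) -> computes m s ->
  computes m (fun a => all (p a) (s a)).
Proof.
move=> Hp Hs; apply: (computes_eq (F := fun a => ~~ has (fun x => ~~ p a x) (s a))).
  by move=> a; elim: (s a) => //= x l <-; rewrite negb_or negbK.
by apply: computes_neg; apply: computes_has => //; cbv beta; apply: computes_neg.
Qed.

Lemma computes_nseq m (F : A -> nat) : computes m F -> computes m (fun a => nseq (F a) tt).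
Proof.
by apply: computes_cast => a; rewrite /enc /enc_of_seq map_nseq.
Qed.

Lemma computes_size_unit m (F : A -> seq unit) :
  computes m F -> computes m (fun a => size (F a)).
Proof.
apply: computes_cast => a; rewrite /enc /enc_of_nat /enc_of_seq.
by elim: (F a) => //= -[] s ->.
Qed.

Lemma computes_size B (EB : Enc B) m (s : A -> seq B) :
  computes m s -> computes m (fun a => size (s a)).
Proof.
move=> Hs; apply: (computes_eq (F := fun a => size (map (fun=> tt) (s a)))).
  by move=> a; rewrite size_map.
by apply: computes_size_unit; apply: computes_map => //; apply: computes_const.
Qed.

Lemma computes_behead B (EB : Enc B) m (s : A -> seq B) :
  computes m s -> computes m (fun a => behead (s a)).
Proof.
move=> Hs; apply: (computes_eq (F := fun a => if s a is x :: r then r else [::])).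
  by move=> a; case: (s a).
apply: (computes_case (m' := fun x => m x.1)) => //.
- exact: computes_const.
- exact/computes_snd/computes_snd/computes_id.
- by apply: pbound_le (pbound_id _) => a; case: (s a).
Qed.

Lemma computes_head B (EB : Enc B) m (x : A -> B) (s : A -> seq B) :
  computes m x -> computes m s -> computes m (fun a => head (x a) (s a)).
Proof.
move=> Hx Hs; apply: (computes_eq (F := fun a => if s a is y :: r then y else x a)).
  by move=> a; case: (s a).
apply: (computes_case (m' := fun x => m x.1)) => //.
- exact/computes_fst/computes_snd/computes_id.
- by apply: pbound_le (pbound_id _) => a; case: (s a).
Qed.

Lemma computes_iter S (ES : Enc S) m (m' : A * S -> nat) (n : A -> nat)
    (f : A -> S -> S) (s0 : A -> S) :
  computes m n -> computes m' (fun x => f x.1 x.2) -> computes m s0 ->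
  (exists2 b, pbound m b & forall a i, i <= n a -> esize (iter i (f a) (s0 a)) <= b a) ->
  (exists2 b, pbound m b &
     forall a i, i < n a -> m' (a, iter i (f a) (s0 a)) <= b a) ->
  computes m (fun a => iter (n a) (f a) (s0 a)).
Proof.
move=> Hn Hf Hs [b1 Hb1 H1] [b2 Hb2 H2].
have itE a l : foldl (fun s (_ : unit) => f a s) (s0 a) l = iter (size l) (f a) (s0 a).
  by elim/last_ind: l => //= l x IH; rewrite foldl_rcons size_rcons IH.
have szE a l1 l2 : nseq (n a) tt = l1 ++ l2 -> n a = size l1 + size l2.
  by rewrite -size_cat => <-; rewrite size_nseq.
apply: (computes_eq (F := fun a => foldl (fun s _ => f a s) (s0 a) (nseq (n a) tt))).
  by move=> a; rewrite itE size_nseq.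
apply: (computes_foldl (m' := fun x => m' x.1)); [exact: computes_nseq|by []|..].
- apply: computes_comp Hf _ _; last exact: pbound_id.
  apply: computes_eq (computes_fst (computes_id _)) => -[[]] //.
- by exists b1 => // a l1 l2 /szE E; rewrite itE; apply: H1; lia.
- by exists b2 => // a l1 x l2 /szE /= E; rewrite itE; apply: H2; lia.
Qed.

End Context.

Section Context.
Context {A : Type} {EA : Enc A}.
Implicit Types m : A -> nat.

Lemma computes_drop B (EB : Enc B) m (n : A -> nat) (s : A -> seq B) :
  computes m n -> computes m s -> computes m (fun a => drop (n a) (s a)).
Proof.
have dE i (r : seq B) : iter i behead r = drop i r.
  by elim: i r => [|i IH] r; rewrite ?drop0 // iterSr IH; case: r.
move=> Hn Hs; apply: (computes_eq (F := fun a => iter (n a) behead (s a))).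
  by move=> a; exact: dE.
apply: (computes_iter (m' := fun x => m x.1)) => //.
- exact/computes_behead/computes_snd/computes_id.
- exists (fun a => esize (s a)); first exact: computes_esize.
  move=> a i _; rewrite dE.
  have := esize_cat EB (take i (s a)) (drop i (s a)); rewrite cat_take_drop.
  have := esize_seq_gt0 EB (take i (s a)); lia.
- by exists m; first exact: pbound_id.
Qed.

Lemma computes_nth B (EB : Enc B) m (x : A -> B) (n : A -> nat) (s : A -> seq B) :
  computes m x -> computes m s -> computes m n -> computes m (fun a => nth (x a) (s a) (n a)).
Proof.
move=> Hx Hs Hn; apply: (computes_eq (F := fun a => head (x a) (drop (n a) (s a)))).
  by move=> a; rewrite -nth0 nth_drop addn0.
by apply: computes_head => //; apply: computes_drop.
Qed.

Lemma computes_sub m (F G : A -> nat) :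
  computes m F -> computes m G -> computes m (fun a => F a - G a).
Proof.
move=> HF HG.
apply: (computes_eq (F := fun a => size (drop (G a) (nseq (F a) tt)))).
  by move=> a; rewrite size_drop size_nseq.
by apply: computes_size; apply: computes_drop => //; apply: computes_nseq.
Qed.

Lemma computes_pred m (F : A -> nat) : computes m F -> computes m (fun a => (F a).-1).
Proof.
move=> HF; apply: (computes_eq (F := fun a => F a - 1)) => [a|]; first by rewrite subn1.
by apply: computes_sub => //; apply: computes_const.
Qed.

Lemma computes_eq0 m (F : A -> nat) : computes m F -> computes m (fun a => F a == 0).
Proof.
move=> HF.
apply: (computes_eq (F := fun a => ~~ has (fun=> true) (nseq (F a) tt))).
  by move=> a; case: (F a).
apply: computes_neg; apply: computes_has; first exact: computes_const.
exact: computes_nseq.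
Qed.

Lemma computes_leq m (F G : A -> nat) :
  computes m F -> computes m G -> computes m (fun a => F a <= G a).
Proof. by move=> HF HG; apply: computes_eq0; apply: computes_sub. Qed.

Lemma computes_eqn m (F G : A -> nat) :
  computes m F -> computes m G -> computes m (fun a => F a == G a).
Proof.
move=> HF HG; apply: (computes_eq (F := fun a => (F a <= G a) && (G a <= F a))).
  by move=> a; rewrite -eqn_leq.
by apply: computes_and; apply: computes_leq.
Qed.

Lemma computes_cat B (EB : Enc B) m (s t : A -> seq B) :
  computes m s -> computes m t -> computes m (fun a => s a ++ t a).
Proof.
move=> Hs Ht.
have fE (u v : seq B) : foldl (fun r x => x :: r) v u = rev u ++ v.
  by rewrite -catrevE; elim: u v => //=.
apply: (computes_eq (F := fun a => foldl (fun r x => x :: r) (t a) (rev (s a)))).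
  by move=> a; rewrite fE revK.
apply: computes_fold => //; first exact: computes_rev.
  apply: computes_cons; first exact/computes_snd/computes_id.
  exact/computes_snd/computes_fst/computes_id.
exists (fun a => esize (s a) + esize (t a)).
  by apply: pbound_add; apply: computes_esize.
move=> a l1 l2 E; rewrite fE -(esize_rev EB (s a)) E.
have := esize_cat EB (rev l1) (t a); have := esize_cat EB l1 l2.
by rewrite esize_rev; have := esize_seq_gt0 EB l2; have := esize_seq_gt0 EB (t a); lia.
Qed.

Lemma computes_add m (F G : A -> nat) :
  computes m F -> computes m G -> computes m (fun a => F a + G a).
Proof.
move=> HF HG.
apply: (computes_eq (F := fun a => size (nseq (F a) tt ++ nseq (G a) tt))).
  by move=> a; rewrite size_cat !size_nseq.
by apply: computes_size; apply: computes_cat; apply: computes_nseq.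
Qed.

Lemma computes_min m (F G : A -> nat) :
  computes m F -> computes m G -> computes m (fun a => minn (F a) (G a)).
Proof.
move=> HF HG; apply: (computes_eq (F := fun a => F a - (F a - G a))).
  by move=> a; rewrite minnE.
by do 2?apply: computes_sub.
Qed.

End Context.

Section Context.
Context {A : Type} {EA : Enc A}.
Implicit Types m : A -> nat.

Lemma computes_flatten B (EB : Enc B) m (s : A -> seq (seq B)) :
  computes m s -> computes m (fun a => flatten (s a)).
Proof.
move=> Hs.
have fE (u : seq (seq B)) : foldl cat [::] u = flatten u.
  rewrite -[RHS]cat0s; elim: u [::] => [|x u IH] r /=; first by rewrite cats0.
  by rewrite IH catA.
apply: (computes_eq (F := fun a => foldl cat [::] (s a))) => [a|]; first exact: fE.
apply: computes_fold => //; first exact: computes_const.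
  apply: computes_cat; last exact/computes_snd/computes_id.
  exact/computes_snd/computes_fst/computes_id.
exists (fun a => esize (s a)); first exact: computes_esize.
move=> a l1 l2 ->; rewrite fE; elim: l1 => [|x l1 IH] /=; first exact: esize_gt0.
by rewrite esize_cons; have := esize_cat EB x (flatten l1); lia.
Qed.

End Context.

Section Context.
Context {A : Type} {EA : Enc A}.
Implicit Types m : A -> nat.

Lemma computes_iota0 m (n : A -> nat) :
  computes m n -> computes m (fun a => iota 0 (n a)).
Proof.
move=> Hn.
have itE i : iter i (fun s => rcons s (size s)) [::] = iota 0 i.
  by elim: i => // i IH; rewrite iterS IH size_iota -cats1 -[i.+1]addn1 iotaD.
apply: (computes_eq (F := fun a => iter (n a) (fun s => rcons s (size s)) [::])) => [a|]; first exact: itE.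
apply: (computes_iter (m' := fun x => m x.1)) => //.
- apply: (computes_eq (F := fun x => x.2 ++ [:: size x.2])) => [x|]; first by rewrite cats1.
  apply: computes_cat; first exact/computes_snd/computes_id.
  apply: computes_cons; last exact: computes_const.
  exact/computes_size/computes_snd/computes_id.
- exact: computes_const.
- exists (fun a => (esize (n a) * (esize (n a)).+1).+1).
    by apply: pbound_succ; apply: pbound_mul; [|apply: pbound_succ]; apply: computes_esize.
  move=> a i le_i; rewrite itE; apply: (@leq_trans (i * (esize (n a)).+1).+1).
    rewrite -[X in X * _](size_iota 0); apply: esize_seq_le => l1 x l2 E.
    have : x \in iota 0 i by rewrite E mem_cat inE eqxx orbT.
    by rewrite mem_iota !esize_nat; lia.
  by rewrite ltnS leq_mul2r esize_nat; lia.
- by exists m; first exact: pbound_id.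
Qed.

Lemma computes_find B (EB : Enc B) m (s : A -> seq B) (p : A -> B -> bool) :
  computes (fun x : A * B => m x.1) (fun x => p x.1 x.2) -> computes m s ->
  computes m (fun a => find (p a) (s a)).
Proof.
move=> Hp Hs.
have fE a (l : seq B) :
    foldl (fun st x => if st.1 then st else if p a x then (true, st.2) else (false, st.2.+1))
      (false, 0) l = (has (p a) l, find (p a) l).
  elim/last_ind: l => //= l x IH; rewrite foldl_rcons IH /= has_rcons -cats1 find_cat.
  case H: (has (p a) l); rewrite /= ?orbT ?orbF // hasNfind ?H //.
  by case: (p a x); rewrite ?addn0 ?addn1.
apply: (computes_eq (F := fun a => (foldl (fun st x => if st.1 then st else
   if p a x then (true, st.2) else (false, st.2.+1)) (false, 0) (s a)).2)).
  by move=> a; rewrite fE.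
apply: computes_snd; apply: computes_fold => //; first exact: computes_const.
  have H2 : computes (fun x : A * (bool * nat) * B => m x.1.1) (fun x => x.1.2).
    exact/computes_snd/computes_fst/computes_id.
  apply: computes_if => //; first exact: computes_fst.
  apply: computes_if.
  - apply: (computes_comp (F := fun x : A * (bool * nat) * B => (x.1.1, x.2)) Hp); last exact: pbound_id.
    by apply: computes_pair; [exact/computes_fst/computes_fst/computes_id|exact/computes_snd/computes_id].
  - by apply: computes_pair; [exact: computes_const|exact: computes_snd].
  - by apply: computes_pair; [exact: computes_const|exact/computes_succ/computes_snd].
exists (fun a => 2 * esize (s a) + 10).
  apply: pbound_add (pbound_const _ _); apply: pbound_mul; first exact: pbound_const.
  exact: computes_esize.
move=> a l1 l2 E; rewrite fE esize_pair esize_nat.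
have := esize_bool (has (p a) l1); have := find_size (p a) l1.
by have := size_esize EB (s a); rewrite E size_cat; lia.
Qed.

Lemma computes_mem (T : eqType) (ET : Enc T) m (F : A -> T) (G : A -> seq T) :
  computes (fun x : A * T => m x.1) (fun x => x.2 == F x.1) -> computes m G ->
  computes m (fun a => F a \in G a).
Proof.
move=> HF HG; apply: (computes_eq (F := fun a => has (fun x => x == F a) (G a))).
  by move=> a; rewrite has_pred1.
exact: computes_has.
Qed.

End Context.

Section Context.
Context {A : Type} {EA : Enc A}.
Implicit Types m : A -> nat.

Lemma computes_memn m (F : A -> nat) (G : A -> seq nat) :
  computes m F -> computes m G -> computes m (fun a => F a \in G a).
Proof.
move=> HF HG; apply: computes_mem => //.
by apply: computes_eqn; [exact/computes_snd/computes_id|exact: computes_ctx].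
Qed.

End Context.

Section Context.
Context {A : Type} {EA : Enc A}.
Implicit Types m : A -> nat.

Lemma computes_eq_seq m (F G : A -> seq nat) :
  computes m F -> computes m G -> computes m (fun a => F a == G a).
Proof.
move=> HF HG; apply: (computes_eq (F := fun a => (size (F a) == size (G a)) &&
   all (fun i => nth 0 (F a) i == nth 0 (G a) i) (iota 0 (size (F a))))).
  move=> a; apply/andP/eqP => [[/eqP E /allP H]|->]; last by split; rewrite ?eqxx //; apply/allP.
  by apply: (@eq_from_nth _ 0) => // i lt; apply/eqP/H; rewrite mem_iota.
apply: computes_and; first by apply: computes_eqn; apply: computes_size.
apply: computes_all; last exact/computes_iota0/computes_size.
by apply: computes_eqn; (apply: computes_nth;
  [exact: computes_const|exact: computes_ctx|exact/computes_snd/computes_id]).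
Qed.

End Context.

(** * The algorithm *)

Section Algorithm.
Variable M : seq (seq bool).

Definition edge u v := nth false (nth [::] M u) v.

Definition vertices := iota 0 (size M).

Definition grow A R := [seq x <- A | (x \in R) || has (fun y => edge y x) R].

(** Walks stay inside [A], and the ball is empty when [u] is not in [A]. *)
Definition ball A i u := iter i (grow A) [seq x <- A | x == u].

Definition comp A u := ball A (size A) u.

Definition nbrs C := [seq x <- vertices | (x \notin C) && has (fun y => edge y x) C].

Definition near i u v := v \in ball vertices i u.

Definition stable i :=
  (0 < i) && all (fun u => all (fun v => near i.-1 u v) (ball vertices i u)) vertices.

(** The minimum of [d] and one plus the largest finite distance. *)
Definition cap d := find stable (iota 0 (minn d (size M).+1)).

Definition minus (A X : seq nat) := [seq x <- A | x \notin X].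

Definition unbalanced W T :=
  has (fun u => size W < size [seq w <- W | w \in comp T u]
                       + size [seq w <- W | w \in comp T u]) T.

Definition min_unbalanced W A :=
  foldl (fun T x => if unbalanced W (minus T [:: x]) then minus T [:: x] else T) A A.

Definition balances W A X := ~~ unbalanced W (minus A X).

Definition expand W A L :=
  flatten [seq [seq t :: X | t <- min_unbalanced W (minus A X)] | X <- L].

(** Freezing [L] once it contains a solution allows [size M] rounds to be run in place of the
    unknown [h]. *)
Definition separator_step W A L := if has (balances W A) L then L else expand W A L.

Definition separators W A := iter (size M) (separator_step W A) [:: [::]].

Definition separator W A := head [::] [seq X <- separators W A | balances W A X].

(** [u] is taken unconditionally so that every round makes progress, even if the separator lies
    outside the component. Separator vertices in the neighbourhood have been chosen before. *)
Definition next_vertices X u :=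
  [seq x <- comp (minus vertices X) u | (x == u) ||
    (x \in separator (nbrs (comp (minus vertices X) u))
             (comp (minus vertices X) u ++ nbrs (comp (minus vertices X) u)))].

Definition extend X :=
  if minus vertices X is u :: _ then next_vertices X u ++ X else X.

Definition elimination_order := iter (size M) extend [::].

Section Tables.
Variable r : nat.

(** The distance in the whole graph, truncated at [r], which also stands for infinity. *)
Definition cdist u v := find (fun i => near i u v) (iota 0 r).

Definition mins (l : seq nat) := foldl minn r l.

(** The filler 0 outside [B] makes all profiles lists indexed by the vertices, so that equal
    distances on [B] give equal lists and [dedup] can merge them. *)
Definition profile (B K : seq nat) :=
  [seq if x \in B then mins [seq cdist u x | u <- K] else 0 | x <- vertices].

Definition mask (B f : seq nat) :=
  [seq if x \in B then nth 0 f x else 0 | x <- vertices].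

Definition dedup (l : seq (seq nat * nat)) :=
  foldl (fun s x => if x \in s then s else x :: s) [::] l.

Definition compatible (f h B : seq nat) := all (fun b => r <= nth 0 f b + nth 0 h b) B.

Definition combine (B' f h B : seq nat) :=
  [seq if x \in B' then minn (nth 0 f x) (mins [seq nth 0 h b + cdist b x | b <- B]) else 0
  | x <- vertices].

(** A vertex set, its neighbourhood, and its table. *)
Definition piece := (seq nat * seq nat * seq (seq nat * nat))%type.

Definition merge B' (T : seq (seq nat * nat)) (p : piece) :=
  dedup (flatten [seq [seq (combine B' x.1 y.1 p.1.2, x.2 + y.2)
                      | y <- [seq y <- p.2 | compatible x.1 y.1 p.1.2]] | x <- T]).

Definition leaf B v := [:: (profile B [::], 0); (profile B [:: v], 1)].

Definition inside (ps : seq piece) v := [seq p <- ps | v \in p.1.2].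

Definition outside (ps : seq piece) v := [seq p <- ps | v \notin p.1.2].

Definition joined (ps : seq piece) v := v :: flatten [seq p.1.1 | p <- inside ps v].

(** During the merging [v] is kept in the boundary, because the pieces to be joined have [v] as a
    neighbour; [eliminate] masks it at the end. *)
Definition joined_table ps v :=
  foldl (merge (v :: nbrs (joined ps v))) (leaf (v :: nbrs (joined ps v)) v) (inside ps v).

Definition eliminate (ps : seq piece) v : seq piece :=
  (joined ps v, nbrs (joined ps v),
    dedup [seq (mask (nbrs (joined ps v)) x.1, x.2) | x <- joined_table ps v])
  :: outside ps v.

Definition pieces := foldl eliminate [::] elimination_order.

Definition final_table := foldl (merge [::]) [:: (profile [::] [::], 0)] pieces.

End Tables.

Definition answer d k := has (fun x => k <= x.2) (final_table (cap d)).

(** * Correctness *)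

Section Correctness.
Hypothesis edge_sym : symmetric edge.
Hypothesis edge_bound : forall u v, edge u v -> u < size M.

Lemma mem_vertices x : (x \in vertices) = (x < size M).
Proof. by rewrite mem_iota. Qed.

Lemma edge_boundr u v : edge u v -> v < size M.
Proof. by rewrite edge_sym; apply: edge_bound. Qed.

Lemma ballP (A : seq nat) (i u x : nat) :
  reflect (exists p, [/\ path edge u p, all (mem A) (u :: p), last u p = x & size p <= i])
          (x \in ball A i u).
Proof.
apply: (iffP idP).
  elim: i x => [|i IH] x.
    by rewrite mem_filter => /andP[/eqP-> uA]; exists [::]; split=> //=; rewrite uA.
  rewrite [ball _ _ _]/= mem_filter => /andP[/orP[/IH[p [ep Ap lp sp]]|]].
    by exists p; split=> //; apply: leqW.
  case/hasP=> y /IH[p [ep Ap lp sp]] yx xA; exists (rcons p x).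
  rewrite rcons_path ep lp yx last_rcons size_rcons ltnS; split=> //.
  by rewrite -rcons_cons all_rcons Ap andbT.
case=> p []; elim: i p x => [|i IH] p x.
  case: p => //= _ /andP[uA _] <- _; by rewrite mem_filter eqxx uA.
case/lastP: p => [|p y].
  move=> ep Ap lp _; rewrite mem_filter; apply/andP; split; last first.
    by rewrite -lp; case/andP: Ap.
  by rewrite [X in _ \in X](_ : _ = ball A i u) // (IH [::] x).
rewrite rcons_path last_rcons size_rcons ltnS -rcons_cons all_rcons.
case/andP=> ep ey /andP[yA Ap] <- sp; rewrite mem_filter [X in _ && X]yA andbT.
by apply/orP; right; apply/hasP; exists (last u p) => //; apply: (IH p).
Qed.

(** [size A] rounds suffice because a duplicate-free path inside [A] has at most that many
    vertices. *)
Lemma compP (A : seq nat) (u x : nat) :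
  reflect (exists p, [/\ path edge u p, all (mem A) (u :: p) & last u p = x])
          (x \in comp A u).
Proof.
apply: (iffP (ballP _ _ _ _)) => -[p]; first by case=> *; exists p.
case=> ep Ap lp; exists (shorten u p).
case: (shortenP ep) lp => q eq uq sub lp; split=> //.
  apply/allP=> y; rewrite inE => /predU1P[->|/sub yp]; first by case/andP: Ap.
  by move/allP: Ap; apply; rewrite inE yp orbT.
rewrite -ltnS; apply: leqW.
apply: (@uniq_leq_size _ (u :: q)) => // y; rewrite inE.
case/predU1P=> [->|/sub yp]; first by case/andP: Ap.
by move/allP: Ap; apply; rewrite inE yp orbT.
Qed.

Lemma comp_sub (A : seq nat) (u : nat) : {subset comp A u <= A}.
Proof. by move=> x /compP[p [_ Ap <-]]; apply: (allP Ap); apply: mem_last. Qed.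

Lemma comp_refl (A : seq nat) (u : nat) : u \in A -> u \in comp A u.
Proof. by move=> uA; apply/compP; exists [::]; rewrite /= uA. Qed.

Lemma comp_trans (A : seq nat) (v u w : nat) : v \in comp A u -> w \in comp A v -> w \in comp A u.
Proof.
move=> /compP[p [ep Ap lp]] /compP[q [eq Aq lq]].
apply/compP; exists (p ++ q); rewrite cat_path last_cat ep lp; split=> //.
by move: Ap Aq => /= /andP[-> Ap] /andP[_ Aq]; rewrite all_cat Ap.
Qed.

Lemma comp_sym (A : seq nat) (u v : nat) : v \in comp A u -> u \in comp A v.
Proof.
move=> /compP[p [ep Ap lp]]; apply/compP; exists (rev (belast u p)).
rewrite -lp rev_path; split.
- by rewrite (eq_path (e' := edge)) // => x y; rewrite edge_sym.
- move: Ap; rewrite lastI all_rcons -[last u p :: _]cat1s all_cat /= andbT => /andP[-> Ap].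
  by rewrite all_rev.
- by case: (p) => //= y q; rewrite rev_cons last_rcons.
Qed.

Lemma comp_mono (A A' : seq nat) (u v : nat) : {subset A <= A'} -> v \in comp A u -> v \in comp A' u.
Proof.
move=> sAA' /compP[p [ep Ap lp]]; apply/compP; exists p; split=> //.
by apply: sub_all Ap.
Qed.

Lemma comp_edge (A : seq nat) (u x y : nat) : x \in comp A u -> edge x y -> y \in A -> y \in comp A u.
Proof.
move=> xu xy yA; apply: (comp_trans xu); apply/compP; exists [:: y].
by rewrite /= xy yA (comp_sub xu).
Qed.

Lemma comp_closed (A C : seq nat) u :
  u \in C -> (forall x y, x \in C -> edge x y -> y \in A -> y \in C) ->
  {subset comp A u <= C}.
Proof.
move=> uC Ccl x /compP[p [ep Ap <-]]; elim: p u uC ep Ap => //= y p IH u uC.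
case/andP=> uy ep /and3P[uA yA Ap]; apply: IH => //=; last by rewrite yA.
exact: Ccl uC uy yA.
Qed.

Lemma nbrsP (C : seq nat) (x : nat) :
  reflect (x \notin C /\ exists2 y, y \in C & edge y x) (x \in nbrs C).
Proof.
rewrite mem_filter mem_vertices -andbA; apply: (iffP and3P).
  by case=> xC /hasP[y yC yx] _; split=> //; exists y.
by case=> xC [y yC yx]; split=> //; [apply/hasP; exists y|apply: edge_boundr yx].
Qed.

Lemma nbrs_sub (C : seq nat) : {subset nbrs C <= vertices}.
Proof. by move=> x; rewrite mem_filter => /andP[]. Qed.

Lemma nbrs_uniq (C : seq nat) : uniq (nbrs C).
Proof. by apply: filter_uniq; apply: iota_uniq. Qed.

Lemma mem_minus (A X : seq nat) (x : nat) : (x \in minus A X) = (x \in A) && (x \notin X).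
Proof. by rewrite mem_filter andbC. Qed.

Lemma minus_uniq (A X : seq nat) : uniq A -> uniq (minus A X).
Proof. exact: filter_uniq. Qed.

Lemma nearP i u v :
  reflect (exists p, [/\ path edge u p, u \in vertices, last u p = v & size p <= i])
          (near i u v).
Proof.
apply: (iffP (ballP _ _ _ _)) => -[p [ep Ap lp sp]]; exists p; split=> //.
  by case/andP: Ap.
rewrite /= Ap /= {Ap lp sp}; elim: p u ep => //= y p IH u /andP[uy ep].
by rewrite mem_vertices (edge_boundr uy) (IH y).
Qed.

Lemma near_last p u : path edge u p -> u \in vertices -> last u p \in vertices.
Proof.
case/lastP: p => //= p y; rewrite rcons_path last_rcons => /andP[_ /edge_boundr h] _.
by rewrite mem_vertices.
Qed.

Lemma near_sym i u v : near i u v = near i v u.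
Proof.
have imp a b : near i a b -> near i b a.
  move=> /nearP[p [ep Ap lp sp]]; apply/nearP; exists (rev (belast a p)).
  rewrite -lp rev_path size_rev size_belast; split=> //.
  - by rewrite (eq_path (e' := edge)) // => x y; rewrite edge_sym.
  - exact: near_last.
  - by case: (p) => //= y q; rewrite rev_cons last_rcons.
by apply/idP/idP; apply: imp.
Qed.

Lemma near_trans i j u v w : near i u v -> near j v w -> near (i + j) u w.
Proof.
move=> /nearP[p [ep Ap lp sp]] /nearP[q [eq Aq lq sq]]; apply/nearP; exists (p ++ q).
by rewrite cat_path last_cat size_cat ep lp; split=> //; apply: leq_add.
Qed.

(** The first vertex of the walk outside [C] is a neighbour of [C], and the length splits there. *)
Lemma near_nbrs (C : seq nat) (i u v : nat) : u \in C -> v \notin C -> near i u v ->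
  exists b j, [/\ b \in nbrs C, j <= i, near j u b & near (i - j) b v].
Proof.
move=> uC vC /nearP[p [ep uV lp]]; elim: p u i uC ep uV lp => [|y p IH] u i uC /=.
  by move=> _ _ uv; rewrite -uv uC in vC.
case/andP=> uy ep uV lp; case: i => // i; rewrite ltnS => sp.
have yV : y \in vertices by rewrite mem_vertices (edge_boundr uy).
have n1 : near 1 u y by apply/nearP; exists [:: y]; rewrite /= uy.
case yC: (y \in C).
  have [b [j [bN le_ji n2 n3]]] := IH y i yC ep yV lp sp.
  exists b, j.+1; split=> //.
  by rewrite -add1n; apply: near_trans n1 n2.
exists y, 1; split=> //; last by rewrite subn1; apply/nearP; exists p.
by apply/nbrsP; rewrite yC; split=> //; exists u.
Qed.

(** * Truncated distances, profiles and exact tables *)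

Section Profiles.
Variable r : nat.
Local Notation cdist := (cdist r).
Local Notation mins := (mins r).
Local Notation profile := (profile r).

Lemma cdist_le u v : cdist u v <= r.
Proof. by rewrite -[X in _ <= X](size_iota 0); apply: find_size. Qed.

Lemma cdist_near u v : cdist u v < r -> near (cdist u v) u v.
Proof.
move=> lt; have /(nth_find 0) : has (fun i => near i u v) (iota 0 r).
  by rewrite has_find size_iota.
by rewrite nth_iota.
Qed.

Lemma near_cdist i u v : near i u v -> cdist u v <= i.
Proof.
move=> n; rewrite leqNgt; apply/negP => lt; have := before_find 0 lt.
by rewrite nth_iota ?n //; apply: leq_trans lt (cdist_le u v).
Qed.

Lemma cdist_sym u v : cdist u v = cdist v u.
Proof. by apply: eq_find => i; rewrite near_sym. Qed.

Lemma cdist_triangle u v w : cdist u w <= cdist u v + cdist v w.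
Proof.
case: (leqP r (cdist u v + cdist v w)) => [|lt]; first exact: leq_trans (cdist_le u w).
by apply: near_cdist; apply: near_trans; apply: cdist_near; lia.
Qed.

(** Separation by [nbrs C], phrased through lower bounds: this form also covers an empty
    neighbourhood, where the truncated distance is [r]. *)
Lemma cdist_nbrs (C : seq nat) (u x z : nat) : u \in C -> x \notin C -> z <= r ->
  (forall b, b \in nbrs C -> z <= cdist u b + cdist b x) -> z <= cdist u x.
Proof.
move=> uC xC zr H; rewrite leqNgt; apply/negP => lt.
have [|b [j [bN le_j n1 n2]]] := near_nbrs uC xC (i := cdist u x).
  by apply: cdist_near; lia.
have := H b bN; have := near_cdist n1; have := near_cdist n2; lia.
Qed.

Lemma leq_mins z l : (z <= mins l) = (z <= r) && all (leq z) l.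
Proof.
rewrite -[mins l]/(foldl minn r l); elim: l r => [|x l IH] s /=; first by rewrite andbT.
by rewrite IH leq_min andbA.
Qed.

(** Minima are compared through their lower bounds: there [mins] turns into a conjunction, and empty
    lists are no special case. *)
Lemma eq_leq_ext a b : (forall z, (z <= a) = (z <= b)) -> a = b.
Proof. by move=> H; apply/eqP; rewrite eqn_leq -H leqnn H leqnn. Qed.

Lemma mins_le l : mins l <= r.
Proof. by have := leqnn (mins l); rewrite leq_mins => /andP[]. Qed.

Lemma nth_map_vertices (g : nat -> nat) x :
  nth 0 (map g vertices) x = if x < size M then g x else 0.
Proof.
case: ltnP => h; last by rewrite nth_default // size_map size_iota.
by rewrite (nth_map 0) ?size_iota // nth_iota.
Qed.

Lemma nth_profile B K x : nth 0 (profile B K) x =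
  if (x < size M) && (x \in B) then mins [seq cdist u x | u <- K] else 0.
Proof. by rewrite nth_map_vertices; case: ltnP. Qed.

Lemma eq_profile B K K' : K =i K' -> profile B K = profile B K'.
Proof.
move=> eqK; apply: eq_map => x; case: ifP => // _; apply: eq_leq_ext => z.
by rewrite !leq_mins !all_map; congr (_ && _); apply: eq_all_r.
Qed.

Definition scattered_in (K : seq nat) :=
  forall u v, u \in K -> v \in K -> u != v -> r <= cdist u v.

(** Distances are those of the whole graph, also between vertices of [C], so an entry keeps its
    meaning when [C] grows. *)
Definition exact (C B : seq nat) (T : seq (seq nat * nat)) := forall f s, (f, s) \in T <->
  exists K : seq nat, [/\ uniq K, {subset K <= C}, scattered_in K, f = profile B K & s = size K].

Lemma mem_dedup l : dedup l =i l.
Proof.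
move=> x; rewrite /dedup -[RHS]orbF -[false]/(x \in [::]).
elim: l [::] => [|y l IH] s //=; rewrite IH inE.
case: ifP => ys; rewrite ?inE; last by case: (x == y); rewrite ?orbT.
by case: eqP => [->|]; rewrite ?ys ?orbT.
Qed.

Lemma dedup_uniq l : uniq (dedup l).
Proof.
rewrite /dedup; have : uniq ([::] : seq (seq nat * nat)) by [].
elim: l [::] => [|y l IH] s //= us; apply: IH; case: ifP => //= ->; exact: us.
Qed.

Lemma mem_merge B' T C B T2 f s :
  (f, s) \in merge r B' T (C, B, T2) <->
  exists x y, [/\ x \in T, y \in T2, compatible r x.1 y.1 B,
                  f = combine r B' x.1 y.1 B & s = x.2 + y.2].
Proof.
rewrite mem_dedup; split.
  case/flattenP=> l /mapP[x xT ->] /mapP[y]; rewrite mem_filter /= => /andP[c yT].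
  by case=> -> ->; exists x, y.
case=> x [y [xT yT c -> ->]]; apply/flattenP.
exists [seq (combine r B' x.1 y.1 B, x.2 + y.2) | y <- [seq y <- T2 | compatible r x.1 y.1 B]].
  by apply/mapP; exists x.
by apply/mapP; exists y => //; rewrite mem_filter c.
Qed.

(** * Combining profiles across the neighbours of a piece *)

Section Merge.
Variables B' C1 C2 K1 K2 : seq nat.
Hypothesis disj : forall x, x \in C1 -> x \notin C2.
Hypothesis B'C2 : forall x, x \in B' -> x \notin C2.
Hypothesis nbrsB' : {subset nbrs C2 <= B'}.
Hypothesis K1C1 : {subset K1 <= C1}.
Hypothesis K2C2 : {subset K2 <= C2}.

(** For [K1] the distances to [B'] are recorded already. A shortest walk from [K2] to a vertex of
    [B'] leaves [C2] through a neighbour, so it is found by the sum in [combine]; the triangle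
    inequality shows that no such sum is too small. *)
Lemma combine_profile :
  combine r B' (profile B' K1) (profile (nbrs C2) K2) (nbrs C2) = profile B' (K1 ++ K2).
Proof.
apply/eq_in_map => x; rewrite mem_vertices => xn; case: ifP => // xB'.
apply: eq_leq_ext => z; rewrite leq_min nth_profile xn xB' /= !leq_mins map_cat all_cat.
case zr: (z <= r) => //=; congr (_ && _); rewrite all_map.
have val b : b \in nbrs C2 ->
    nth 0 (profile (nbrs C2) K2) b = mins [seq cdist u b | u <- K2].
  by move=> bN; rewrite nth_profile bN -mem_vertices (nbrs_sub bN).
apply/allP/allP => [H d /mapP[u uK ->]|H b bN] /=.
  apply: (@cdist_nbrs C2) => //; [exact: K2C2|exact: B'C2|] => b bN.
  apply: leq_trans (H b bN) _; rewrite /= val // leq_add2r.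
  have := leqnn (mins [seq cdist u b | u <- K2]); rewrite leq_mins => /andP[_ /allP]; apply.
  by apply/mapP; exists u.
rewrite val //.
suff : z - cdist b x <= mins [seq cdist u b | u <- K2] by lia.
rewrite leq_mins; apply/andP; split; first by lia.
apply/allP=> d /mapP[u uK ->].
have /= := H (cdist u x) (map_f _ uK); have := cdist_triangle u b x; lia.
Qed.

(** Every walk between the two sets crosses a neighbour [b] of [C2], where the sum of the two minima
    bounds its length from below. Conversely a small sum at [b] gives a close pair by the triangle
    inequality. *)
Lemma compatible_profile :
  compatible r (profile B' K1) (profile (nbrs C2) K2) (nbrs C2) <->
  (forall u x, u \in K1 -> x \in K2 -> r <= cdist u x).
Proof.
have val b : b \in nbrs C2 ->
    nth 0 (profile B' K1) b = mins [seq cdist u b | u <- K1] /\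
    nth 0 (profile (nbrs C2) K2) b = mins [seq cdist u b | u <- K2].
  by move=> bN; rewrite !nth_profile bN (nbrsB' bN) -mem_vertices (nbrs_sub bN).
split=> [/allP H u x uK xK|H].
  rewrite cdist_sym; apply: (@cdist_nbrs C2) => //; first exact: K2C2.
    exact/disj/K1C1.
  move=> b bN; have /= := H b bN; have [-> ->] := val b bN.
  have := leqnn (mins [seq cdist u b | u <- K1]); rewrite leq_mins => /andP[_ /allP].
  move=> /(_ _ (map_f _ uK)) /=.
  have := leqnn (mins [seq cdist u b | u <- K2]); rewrite leq_mins => /andP[_ /allP].
  move=> /(_ _ (map_f _ xK)) /=.
  by rewrite (cdist_sym b u); lia.
apply/allP=> b bN /=; have [-> ->] := val b bN.
suff : r - mins [seq cdist u b | u <- K2] <= mins [seq cdist u b | u <- K1] by lia.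
rewrite leq_mins leq_subr; apply/allP=> d /mapP[u uK ->] /=.
suff : r - cdist u b <= mins [seq cdist u b | u <- K2].
  by rewrite !leq_subLR addnC.
rewrite leq_mins leq_subr; apply/allP=> d' /mapP[x xK ->] /=.
have := H u x uK xK; have := cdist_triangle u b x.
by rewrite (cdist_sym b x); lia.
Qed.

Lemma scattered_cat :
  scattered_in (K1 ++ K2) <->
  [/\ scattered_in K1, scattered_in K2 & forall u x, u \in K1 -> x \in K2 -> r <= cdist u x].
Proof.
split=> [H|[H1 H2 H3]].
  split=> [u v uK vK|u v uK vK|u x uK xK]; apply: H; rewrite ?mem_cat ?uK ?vK ?xK ?orbT //.
  apply: contraTneq (K1C1 uK) => ->; apply/negP => /disj.
  by rewrite K2C2.
move=> u v; rewrite !mem_cat => /orP[uK|uK] /orP[vK|vK] uv; first exact: H1.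
- exact: H3.
- by rewrite cdist_sym; apply: H3.
- exact: H2.
Qed.

End Merge.

(** A set is split into its elements in [C1] and the others. The two parts interact only through the
    neighbours of [C2], which lie in [B'], so both profiles are known there. *)
Lemma exact_merge (B' C1 C2 : seq nat) T1 T2 :
  (forall x, x \in C1 -> x \notin C2) -> (forall x, x \in B' -> x \notin C2) ->
  {subset nbrs C2 <= B'} -> exact C1 B' T1 -> exact C2 (nbrs C2) T2 ->
  exact (C1 ++ C2) B' (merge r B' T1 (C2, nbrs C2, T2)).
Proof.
move=> disj B'C2 nB' ex1 ex2 f s; rewrite mem_merge; split.
  case=> -[f1 s1] [[f2 s2] [/ex1[K1 [u1 K1C1 sc1 -> ->]] /ex2[K2 [u2 K2C2 sc2 -> ->]]]] /=.
  rewrite (combine_profile _ B'C2 K2C2) => c -> ->; exists (K1 ++ K2).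
  move/(compatible_profile disj nB' K1C1 K2C2): c => cross.
  split=> //; last by rewrite size_cat.
  - rewrite cat_uniq u1 u2 andbT; apply/hasPn => x /K2C2 xC2; apply/negP => /K1C1 /disj.
    by rewrite xC2.
  - by move=> x; rewrite !mem_cat => /orP[/K1C1|/K2C2] ->; rewrite ?orbT.
  - exact/(scattered_cat disj K1C1 K2C2).
case=> K [uK KC sc -> ->].
pose K1 := [seq x <- K | x \in C1]; pose K2 := [seq x <- K | x \notin C1].
have K1C1 : {subset K1 <= C1} by move=> x; rewrite mem_filter => /andP[].
have K2C2 : {subset K2 <= C2}.
  by move=> x; rewrite mem_filter => /andP[xC1 /KC]; rewrite mem_cat (negbTE xC1).
have eqK : K =i K1 ++ K2.
  by move=> x; rewrite mem_cat !mem_filter; case: (x \in C1); rewrite ?orbF.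
have sc12 : scattered_in (K1 ++ K2) by move=> u v; rewrite -!eqK; apply: sc.
have [sc1 sc2 cross] := (scattered_cat disj K1C1 K2C2).1 sc12.
exists (profile B' K1, size K1), (profile (nbrs C2) K2, size K2); split=> /=.
- by apply/ex1; exists K1; split=> //; apply: filter_uniq.
- by apply/ex2; exists K2; split=> //; apply: filter_uniq.
- exact/(compatible_profile disj nB' K1C1 K2C2).
- by rewrite (combine_profile _ B'C2 K2C2); apply: eq_profile.
- by rewrite !size_filter count_predC.
Qed.


Lemma exact_leaf B v : exact [:: v] B (leaf r B v).
Proof.
move=> f s; rewrite !inE; split.
  case/orP=> /eqP[-> ->]; first by exists [::]; split.
  exists [:: v]; split=> // x y; rewrite !inE => /eqP-> /eqP->.
  by rewrite eqxx.
case=> K [uK KC _ -> ->]; case: K uK KC => [|x K] uK KC; first by rewrite eqxx.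
have E : x = v by apply/eqP; rewrite -mem_seq1; apply: KC; rewrite mem_head.
case: K uK KC => [|y K] uK KC; first by rewrite E eqxx orbT.
have : y \in [:: v] by apply: KC; rewrite !inE eqxx orbT.
by rewrite mem_seq1 => /eqP yv; move: uK; rewrite E yv /= mem_head.
Qed.

Lemma eq_exact C C' B T : C =i C' -> exact C B T -> exact C' B T.
Proof.
move=> eqC ex f s; split.
  by case/ex=> K [? KC ? ? ?]; exists K; split=> // x /KC; rewrite eqC.
by case=> K [? KC ? ? ?]; apply/ex; exists K; split=> // x /KC; rewrite eqC.
Qed.

Lemma eq_exact_table C B T T' : T =i T' -> exact C B T -> exact C B T'.
Proof. by move=> eqT ex f s; rewrite -eqT. Qed.

Lemma exact_mask C B B' T : {subset B <= B'} -> exact C B' T ->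
  exact C B [seq (mask B x.1, x.2) | x <- T].
Proof.
move=> sBB' ex f s.
have maskE K : mask B (profile B' K) = profile B K.
  apply/eq_in_map => x; rewrite mem_vertices => xn; case: ifP => // xB.
  by rewrite nth_profile xn sBB'.
split.
  by case/mapP=> -[f1 s1] /ex[K [? ? ? -> ->]] [-> ->]; exists K; split.
case=> K [? ? ? -> ->]; apply/mapP; exists (profile B' K, size K) => //=.
  by apply/ex; exists K.
by rewrite maskE.
Qed.

(** The last two conditions make a nonempty piece a full component of the eliminated part [U]. Its
    neighbourhood is then one of those controlled by the width of the order. *)
Definition piece_ok (U : seq nat) (p : piece) :=
  [/\ p.1.2 = nbrs p.1.1, exact p.1.1 p.1.2 p.2, {subset p.1.1 <= U},
      forall x, x \in p.1.2 -> x \notin U &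
      forall x y, x \in p.1.1 -> y \in p.1.1 -> y \in comp U x].

Definition pieces_ok (U : seq nat) (ps : seq piece) :=
  [/\ forall p, p \in ps -> piece_ok U p, uniq (flatten [seq p.1.1 | p <- ps]) &
      flatten [seq p.1.1 | p <- ps] =i U].

(** * Eliminating one vertex *)

Section Eliminate.
Variables (U : seq nat) (ps : seq piece) (v : nat).
Hypothesis ps_ok : pieces_ok U ps.
Hypothesis vU : v \notin U.

Lemma mem_joined x : (x \in joined ps v) =
  (x == v) || has (fun p : piece => (v \in p.1.2) && (x \in p.1.1)) ps.
Proof.
rewrite inE; congr (_ || _); apply/flattenP/hasP => [[C /mapP[p]]|[p pps /andP[vp xp]]].
  by rewrite mem_filter => /andP[vp pps] -> xp; exists p; rewrite ?vp.
by exists p.1.1 => //; apply/mapP; exists p; rewrite ?mem_filter ?vp.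
Qed.

Lemma piece_of x : x \in U -> exists2 p, p \in ps & x \in p.1.1.
Proof.
case: ps_ok => _ _ <- /flattenP[C /mapP[p pps ->] xp]; by exists p.
Qed.

(** A vertex of [U] adjacent to [v] lies in a piece that has [v] as a neighbour, hence was joined.
    One adjacent to a joined piece belongs to it, as neighbours of pieces avoid [U]. *)
Lemma nbrs_joined x : x \in nbrs (joined ps v) -> x \notin v :: U.
Proof.
case/nbrsP; rewrite mem_joined negb_or inE => /andP[xv /hasPn nC] [y yC yx].
rewrite (negbTE xv) /=; apply/negP => xU; have [p pps xp] := piece_of xU.
case: ps_ok => ok _ _; have [E _ _ nU _] := ok p pps.
move: (nC p pps); rewrite xp andbT => vp.
move: yC; rewrite mem_joined => /orP[/eqP yv|/hasP[q qps /andP[vq yq]]].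
  case/negP: vp; rewrite E; apply/nbrsP; split; last by exists x; rewrite // edge_sym -yv.
  by apply: contra vU; case: (ok p pps) => _ _ sub _ _; apply: sub.
have [Eq _ _ nUq _] := ok q qps.
case xq : (x \in q.1.1).
  by move: (nC q qps); rewrite vq xq.
have xN : x \in q.1.2 by rewrite Eq; apply/nbrsP; rewrite xq; split=> //; exists y.
by move: (nUq x xN); rewrite xU.
Qed.

Lemma inside_nbrs p : p \in inside ps v -> {subset nbrs p.1.1 <= v :: nbrs (joined ps v)}.
Proof.
rewrite mem_filter => /andP[vp pps] x xN; rewrite inE; apply/orP.
case: (eqVneq x v) => xv; [by left|right].
case: ps_ok => ok _ _; have [E _ sub nU _] := ok p pps.
case/nbrsP: (xN) => xp [y yp yx].
apply/nbrsP; split; last first.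
  by exists y => //; rewrite mem_joined; apply/orP; right; apply/hasP; exists p; rewrite ?vp.
rewrite mem_joined negb_or xv /=; apply/hasPn => q qps; rewrite negb_and orbC.
case xq : (x \in q.1.1) => //=; case: (ok q qps) => _ _ subq _ _.
by move: (nU x); rewrite E xN subq // => /(_ isT).
Qed.

Lemma inside_disjoint p x : p \in inside ps v ->
  x \in v :: nbrs (joined ps v) -> x \notin p.1.1.
Proof.
rewrite mem_filter => /andP[vp pps].
case: ps_ok => ok _ _; have [E _ sub nU _] := ok p pps.
rewrite inE => /predU1P[->|/nbrsP[xC _]]; first by apply: contra vU; apply: sub.
move: xC; rewrite mem_joined negb_or => /andP[_ /hasPn/(_ p pps)].
by rewrite vp.
Qed.

(** Stated for prefixes because exactness of the partial tables is also what bounds their sizes. *)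
Lemma exact_joined l1 l2 : inside ps v = l1 ++ l2 ->
  exact (v :: flatten [seq p.1.1 | p <- l1]) (v :: nbrs (joined ps v))
    (foldl (merge r (v :: nbrs (joined ps v))) (leaf r (v :: nbrs (joined ps v)) v) l1).
Proof.
elim/last_ind: l1 l2 => [|l1 p IH] l2 E; first exact: exact_leaf.
have pin : p \in inside ps v by rewrite E mem_cat mem_rcons mem_head.
have pps : p \in ps by move: pin; rewrite mem_filter => /andP[].
rewrite foldl_rcons; have {}IH := IH (p :: l2); rewrite -cat_rcons in IH.
have := IH E => {}IH; case: ps_ok => ok uF _; have [Ep ex sub nU _] := ok p pps.
apply: (@eq_exact ((v :: flatten [seq p.1.1 | p <- l1]) ++ p.1.1)).
  move=> x; rewrite mem_cat !inE -orbA; congr (_ || _).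
  by rewrite -cats1 map_cat flatten_cat /= cats0 mem_cat.
case: p {pps} pin Ep ex sub nU E => -[C B] T /= pin -> ex sub nU E.
rewrite -cat_cons; apply: exact_merge => //.
- move=> x; rewrite inE => /predU1P[->|xl]; first by apply: contra vU; apply: sub.
  have : uniq (flatten [seq p.1.1 | p <- inside ps v]).
    apply: subseq_uniq uF; rewrite /inside.
    elim: (ps) => //= q qs sub'; case: ifP => _ /=; first exact: cat_subseq.
    by apply: subseq_trans sub' _; apply: suffix_subseq.
  rewrite E map_cat flatten_cat cat_uniq map_rcons -cats1 flatten_cat cat_uniq /= cats0.
  case/andP=> /and3P[_ /hasPn h _] _; apply/negP => /h /=.
  by rewrite xl.
- by move=> x; apply: (inside_disjoint pin).
- exact: (inside_nbrs pin).
Qed.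

Lemma eliminate_ok : pieces_ok (v :: U) (eliminate r ps v).
Proof.
case: (ps_ok) => ok uF eqU.
have permF : perm_eq (flatten [seq p.1.1 | p <- eliminate r ps v])
                     (v :: flatten [seq p.1.1 | p <- ps]).
  rewrite /eliminate /= /joined /= perm_cons -flatten_cat -map_cat.
  apply: perm_flatten; apply: perm_map; apply/permPl; exact: perm_filterC.
split; last 2 first.
- by rewrite (perm_uniq permF) /= uF eqU vU.
- by move=> x; rewrite (perm_mem permF) !inE eqU.
have subU : {subset U <= v :: U} by move=> x xU; rewrite inE xU orbT.
move=> p; rewrite inE => /predU1P[->|]; last first.
  rewrite mem_filter => /andP[vp pps]; have [E ex sub nU cn] := ok p pps.
  split=> //.
  - by move=> x /sub; apply: subU.
  - by move=> x xp; rewrite inE negb_or nU // andbT; apply: contraTneq xp => ->.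
  - by move=> x y xp yp; apply: comp_mono subU (cn x y xp yp).
have conn y : y \in joined ps v -> v \in comp (v :: U) y.
  rewrite mem_joined => /orP[/eqP->|/hasP[p' pps /andP[vp yp]]].
    by apply: comp_refl; rewrite mem_head.
  have [E ex sub nU cn] := ok p' pps; move: vp; rewrite E => /nbrsP[_ [z zp zv]].
  by apply: (comp_edge (x := z)) => //; [apply: comp_mono subU (cn _ _ yp zp)|apply: mem_head].
split=> //=.
- apply: eq_exact_table (exact_mask (B' := v :: nbrs (joined ps v)) _ _).
  + by move=> x; rewrite mem_dedup.
  + by move=> x xN; rewrite inE xN orbT.
  + by apply: (@exact_joined _ [::]); rewrite cats0.
- move=> x; rewrite mem_joined => /orP[/eqP->|/hasP[p' pps /andP[_ xp]]]; first exact: mem_head.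
  by apply: subU; case: (ok p' pps) => _ _ sub _ _; apply: sub.
- exact: nbrs_joined.
- by move=> x y xC yC; apply: comp_trans (conn x xC) _; apply/comp_sym/conn.
Qed.

End Eliminate.

Lemma pieces_ok_foldl l U ps : pieces_ok U ps -> uniq (l ++ U) ->
  pieces_ok (rev l ++ U) (foldl (eliminate r) ps l).
Proof.
elim: l U ps => [|v l IH] U ps ok //= /andP[vlU ulU]; rewrite rev_cons cat_rcons.
apply: IH; first by apply: eliminate_ok => //; apply: contra vlU; rewrite mem_cat => ->; rewrite orbT.
by rewrite -cat_rcons -cats1 -catA uniq_catCA /= vlU.
Qed.

Lemma pieces_ok_nil : pieces_ok [::] [::].
Proof. by split. Qed.

(** Once all vertices are eliminated the pieces have no neighbours, so the empty boundary suffices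
    and all pairs of entries are compatible. Prefixes again serve the size bounds. *)
Lemma exact_final ps l1 l2 : pieces_ok vertices ps -> ps = l1 ++ l2 ->
  exact (flatten [seq p.1.1 | p <- l1]) [::]
    (foldl (merge r [::]) [:: (profile [::] [::], 0)] l1).
Proof.
move=> [ok uF eqU]; elim/last_ind: l1 l2 => [|l1 p IH] l2 E.
  move=> f s; rewrite mem_seq1; split=> [/eqP[-> ->]|[[|x K] [_ KC _ -> ->]]] //.
    by exists [::]; split.
  by have := KC x; rewrite mem_head => /(_ isT).
have pps : p \in ps by rewrite E mem_cat mem_rcons mem_head.
rewrite foldl_rcons; have {}IH := IH (p :: l2); rewrite -cat_rcons in IH.
have := IH E => {}IH; have [Ep ex sub nU _] := ok p pps.
apply: (@eq_exact (flatten [seq p.1.1 | p <- l1] ++ p.1.1)).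
  by move=> x; rewrite -cats1 map_cat flatten_cat /= cats0.
case: p {pps} Ep ex sub nU E => -[C B] T /= -> ex sub nU E.
apply: exact_merge => //.
- move=> x xl; move: uF.
  rewrite E map_cat flatten_cat cat_uniq map_rcons -cats1 flatten_cat cat_uniq /= cats0.
  by case/andP=> /and3P[_ /hasPn h _] _; apply/negP => /h /=; rewrite xl.
- by move=> x xN; case/negP: (nU x xN); apply: nbrs_sub xN.
Qed.

End Profiles.

(** ** The elimination order *)

Lemma next_vertices_sub (X : seq nat) u : {subset next_vertices X u <= minus vertices X}.
Proof. by move=> x; rewrite mem_filter => /andP[_]; apply: comp_sub. Qed.

Lemma comp_uniq (A : seq nat) u : uniq A -> uniq (comp A u).
Proof.
rewrite /comp /ball => uA; case: (size A) => [|i]; last by rewrite iterS; apply: filter_uniq.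
exact: filter_uniq.
Qed.

Lemma next_vertices_uniq (X : seq nat) u : uniq (next_vertices X u).
Proof. by apply/filter_uniq/comp_uniq/filter_uniq/iota_uniq. Qed.

Lemma extend_ok (X : seq nat) : uniq X -> {subset X <= vertices} ->
  [/\ uniq (extend X), {subset extend X <= vertices} &
      size X < size M -> size X < size (extend X)].
Proof.
move=> uX sX; rewrite /extend; case E: (minus vertices X) => [|u s].
  split=> // lt; have : size vertices <= size X.
    apply: uniq_leq_size; first exact: iota_uniq.
    move=> x xV; apply: contraT => xX; have : x \in minus vertices X by rewrite mem_minus xV.
    by rewrite E.
  by rewrite size_iota; lia.
have sub := @next_vertices_sub X u.
have uin : u \in next_vertices X u.
  by rewrite mem_filter eqxx /=; apply: comp_refl; rewrite E mem_head.
split.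
- rewrite cat_uniq next_vertices_uniq uX andbT; apply/hasPn => x xX; apply/negP => /sub.
  by rewrite mem_minus xX andbF.
- by move=> x; rewrite mem_cat => /orP[/sub|/sX//]; rewrite mem_minus => /andP[].
- by case: (next_vertices X u) uin => //= y t _; rewrite size_cat; lia.
Qed.

Lemma iter_extend_ok i : [/\ uniq (iter i extend [::]), {subset iter i extend [::] <= vertices} &
  minn i (size M) <= size (iter i extend [::])].
Proof.
elim: i => [|i [u s le]]; first by rewrite min0n.
rewrite iterS; have [u' s' le'] := extend_ok u s; split=> //.
case: (ltnP (size (iter i extend [::])) (size M)) => [/le'|h]; first by lia.
have : size (iter i extend [::]) <= size (extend (iter i extend [::])).
  rewrite /extend; case: minus => // *; rewrite size_cat; lia.
by lia.
Qed.

Lemma elimination_order_uniq : uniq elimination_order.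
Proof. by case: (iter_extend_ok (size M)). Qed.

Lemma mem_elimination_order : elimination_order =i vertices.
Proof.
case: (iter_extend_ok (size M)) => u s le.
apply: (uniq_min_size u s _).2; by rewrite size_iota -[X in X <= _]minnn.
Qed.

Lemma elimination_order_ok r i :
  pieces_ok r (rev (take i elimination_order))
    (foldl (eliminate r) [::] (take i elimination_order)).
Proof.
rewrite -[rev _]cats0; apply: pieces_ok_foldl; first exact: pieces_ok_nil.
by rewrite cats0; apply: take_uniq; apply: elimination_order_uniq.
Qed.

Lemma pieces_ok_final r : pieces_ok r vertices (pieces r).
Proof.
have := elimination_order_ok r (size elimination_order); rewrite take_size => -[ok u eqU].
have eqV : rev elimination_order =i vertices.
  by move=> x; rewrite mem_rev mem_elimination_order.
split=> //; last by move=> x; rewrite eqU eqV.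
move=> p /ok[E ex sub nU cn]; split=> //.
- by move=> x /sub; rewrite eqV.
- by move=> x /nU; rewrite eqV.
- by move=> x y xp yp; apply: comp_mono (cn x y xp yp) => z; rewrite eqV.
Qed.

Lemma final_tableP r k : has (fun x => k <= x.2) (final_table r) <->
  exists K, [/\ uniq K, {subset K <= vertices}, scattered_in r K & k <= size K].
Proof.
have ok := pieces_ok_final r.
have := exact_final ok (l1 := pieces r) (l2 := [::]); rewrite cats0 => /(_ erefl) ex.
have {}ex := eq_exact (let: And3 _ _ e := ok in e) ex.
split=> [/hasP[[f s] /ex[K [? ? ? _ ->]] /= le]|[K [? ? ? le]]]; first by exists K.
by apply/hasP; exists (profile r [::] K, size K) => //; apply/ex; exists K.
Qed.

(** ** The distance cap *)

(** Otherwise [cap d] is a stable length at most [j], and the first [cap d] edges of a shortest walk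
    can be replaced by fewer. *)
Lemma unstable_near d u v j : near j u v -> (forall i, i < j -> ~~ near i u v) ->
  j < d -> j < size M -> j < cap d.
Proof.
move=> nj mj jd jn; rewrite ltnNge; apply/negP => le.
have lt : cap d < minn d (size M).+1 by lia.
have st : stable (cap d).
  have /(nth_find 0) : has stable (iota 0 (minn d (size M).+1)).
    by rewrite has_find size_iota.
  by rewrite nth_iota.
case/andP: st => c0 /allP st.
case/nearP: nj => p [ep uV lp sp].
have szp : size p = j.
  apply/eqP; rewrite eqn_leq sp leqNgt; apply/negP => lt'.
  by case/negP: (mj _ lt'); apply/nearP; exists p.
pose c := cap d.
have n1 : near c u (last u (take c p)).
  apply/nearP; exists (take c p); rewrite size_take_min; split=> //; last by lia.
  by move: ep; rewrite -{1}(cat_take_drop c p) cat_path => /andP[].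
have n2 := allP (st u uV) _ n1.
have n3 : near (j - c) (last u (take c p)) v.
  apply/nearP; exists (drop c p); rewrite size_drop szp; split=> //.
  - by move: ep; rewrite -{1}(cat_take_drop c p) cat_path => /andP[].
  - by apply: near_last => //; move: ep; rewrite -{1}(cat_take_drop c p) cat_path => /andP[].
  - by rewrite -last_cat cat_take_drop.
have := near_trans n2 n3; apply/negP; apply: mj; rewrite /c in n3 *; lia.
Qed.

Lemma cap_le d : cap d <= d.
Proof.
apply: leq_trans (find_size _ _) _; rewrite size_iota; exact: geq_minl.
Qed.

Lemma near_size i u v : near i u v -> near (size M).-1 u v.
Proof.
case/nearP=> p [ep uV lp sp]; apply/nearP; exists (shorten u p).
case: (shortenP ep) lp => q eq uq _ lp; split=> //.
have : size (u :: q) <= size vertices.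
  apply: uniq_leq_size => // x; rewrite inE => /predU1P[->//|xq].
  case/splitPr: xq eq => q1 q2; rewrite cat_path mem_vertices /= => /and3P[_ /edge_boundr //].
by rewrite size_iota /=; lia.
Qed.

(** No finite distance lies between [cap d] and [d], so the capped condition is equivalent to the
    original one. *)
Lemma capP d u v : (cap d <= cdist (cap d) u v) <-> (forall i, i < d -> ~~ near i u v).
Proof.
split=> [le i lt|H]; last first.
  rewrite leqNgt; apply/negP => lt; have := H _ (leq_trans lt (cap_le d)).
  by rewrite cdist_near.
apply/negP => n.
have ex : exists j, near j u v by exists i.
case: (ex_minnP ex) => j nj mj.
have ji := mj _ n.
have jn : j < size M.
  have := mj _ (near_size n); case/nearP: nj => p [_ + _ _]; rewrite mem_vertices; lia.
have lt' : j < cap d.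
  apply: (unstable_near nj) => //; last by lia.
  by move=> j' lt'; apply/negP => /mj; lia.
by have := near_cdist (cap d) nj; lia.
Qed.

Lemma answerP d k : answer d k <-> exists K : seq nat, [/\ uniq K, {subset K <= vertices},
  forall u v, u \in K -> v \in K -> u != v -> forall i, i < d -> ~~ near i u v &
  k <= size K].
Proof.
rewrite /answer final_tableP; split=> -[K [? ? sc ?]]; exists K; split=> //.
  by move=> u v uK vK uv; apply/capP; apply: sc.
by move=> u v uK vK uv; apply/capP; apply: sc.
Qed.

End Correctness.
End Algorithm.

(** * Tree-depth bounds *)

Lemma seq_argmax (s : seq nat) (g : nat -> nat) (P : pred nat) : has P s ->
  exists x, [/\ x \in s, P x & forall y, y \in s -> P y -> g y <= g x].
Proof.
elim: s => //= x s IH; case hs: (has P s).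
  have [y [ys Py my]] := IH hs => _.
  case Px: (P x); last first.
    exists y; split; rewrite ?inE ?ys ?orbT // => z.
    by rewrite inE => /predU1P[->|/my//]; rewrite Px.
  case: (leqP (g x) (g y)) => le.
    exists y; split; rewrite ?inE ?ys ?orbT // => z.
    by rewrite inE => /predU1P[->//|/my].
  exists x; split; rewrite ?inE ?eqxx // => z; rewrite inE => /predU1P[->//|zs Pz].
  by apply: ltnW; apply: leq_ltn_trans le; apply: my.
rewrite orbF => Px; exists x; split; rewrite ?mem_head // => z.
rewrite inE => /predU1P[->//|zs Pz].
by move/hasPn: (negbT hs) => /(_ z zs); rewrite Pz.
Qed.

Section TreeDepth.
Variable M : seq (seq bool).
Local Notation edge := (edge M).
Local Notation vertices := (vertices M).
Local Notation comp := (comp M).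
Local Notation nbrs := (nbrs M).
Hypothesis edge_sym : symmetric edge.
Hypothesis edge_bound : forall u v, edge u v -> u < size M.

(** The restriction to the vertices of the order of a rooted forest of height [h]. *)
Variables (anc : rel nat) (dep : nat -> nat) (h : nat).
Hypothesis anc_refl : forall x, x \in vertices -> anc x x.
Hypothesis anc_trans : transitive anc.
Hypothesis anc_linear : forall x y z, anc x z -> anc y z -> anc x y \/ anc y x.
Hypothesis anc_dep : forall x y, anc x y -> x != y -> dep x < dep y.
Hypothesis dep_gt0 : forall x, x \in vertices -> 0 < dep x.
Hypothesis dep_le : forall x, x \in vertices -> dep x <= h.
Hypothesis edge_anc : forall x y, edge x y -> anc x y \/ anc y x.

Lemma path_vertices (u : nat) p : u \in vertices -> path edge u p ->
  {subset u :: p <= vertices}.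
Proof.
elim: p u => [|y p IH] u uV /=; first by move=> _ x; rewrite inE => /eqP->.
case/andP=> uy ep x; rewrite inE => /predU1P[->//|]; apply: IH => //.
by rewrite mem_vertices; apply: (edge_boundr edge_sym edge_bound) uy.
Qed.

(** The next vertex is comparable with the end of the path; as the ancestors of a node form a chain,
    it is comparable with the top found so far, and the upper of the two is the new top. *)
Lemma path_top (u : nat) p : u \in vertices -> path edge u p ->
  exists2 t, t \in u :: p & forall x, x \in u :: p -> anc t x.
Proof.
elim/last_ind: p => [|p y IH] uV.
  by move=> _; exists u => [|x]; rewrite inE // => /eqP->; apply: anc_refl.
rewrite rcons_path => /andP[ep ey]; have [t tp ht] := IH uV ep.
have yV : y \in vertices by rewrite mem_vertices; apply: (edge_boundr edge_sym edge_bound) ey.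
have tl := ht _ (mem_last u p).
have [ty|yt] : anc t y \/ anc y t.
- case: (edge_anc ey) => e; first by left; apply: anc_trans e.
  exact: anc_linear tl e.
- exists t; first by rewrite -rcons_cons mem_rcons inE tp orbT.
  by move=> x; rewrite -rcons_cons mem_rcons inE => /predU1P[->|/ht].
- exists y; first by rewrite -rcons_cons mem_rcons mem_head.
  move=> x; rewrite -rcons_cons mem_rcons inE => /predU1P[->|/ht]; first exact: anc_refl.
  exact: anc_trans.
Qed.

(** Removing its top vertex splits the path into two paths that lie strictly deeper; [j] is the
    number of levels left. *)
Lemma sorted_size j (s : seq nat) : sorted edge s -> uniq s -> {subset s <= vertices} ->
  (forall x, x \in s -> h < dep x + j) -> size s < 2 ^ j.
Proof.
elim: j s => [|j IH] [|u p] ep us sV hs; [by []| |by rewrite expn_gt0|].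
  by have uV := sV u (mem_head _ _); have := hs u (mem_head _ _); have := dep_le uV; lia.
have [t tp ht] := path_top (sV u (mem_head _ _)) ep.
case/splitPr: tp ep us sV hs ht => s1 s2 ep us sV hs ht.
have sub1 x : x \in s1 -> [/\ x \in s1 ++ t :: s2 & t != x].
  move=> xs; split; first by rewrite mem_cat xs.
  move: us; rewrite cat_uniq => /and3P[_ /hasPn/(_ t) + _].
  by rewrite mem_head => /(_ isT) /=; apply: contraNneq => ->.
have sub2 x : x \in s2 -> [/\ x \in s1 ++ t :: s2 & t != x].
  move=> xs; split; first by rewrite mem_cat inE xs !orbT.
  move: us; rewrite cat_uniq => /and3P[_ _ /= /andP[+ _]].
  by apply: contraNneq => ->.
have hj x : x \in s1 ++ t :: s2 -> t != x -> h < dep x + j.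
  by move=> xs tx; have := anc_dep (ht x xs) tx; have := hs t; rewrite mem_cat mem_head orbT => /(_ isT); lia.
have [e1 e2] : sorted edge s1 /\ sorted edge s2.
  have [-> e] := cat_sorted2 ep; split=> //.
  exact: path_sorted e.
have [u1 u2] : uniq s1 /\ uniq s2.
  by move: us; rewrite cat_uniq => /and3P[-> _ /= /andP[_ ->]].
have := IH s1 e1 u1; have := IH s2 e2 u2.
rewrite size_cat /= expnS mul2n -addnn.
move=> H2 H1; have {}H1 : size s1 < 2 ^ j.
  by apply: H1 => x /sub1[xs tx]; [apply: sV|apply: hj].
have {}H2 : size s2 < 2 ^ j.
  by apply: H2 => x /sub2[xs tx]; [apply: sV|apply: hj].
by rewrite -addSn leq_add.
Qed.

Lemma path_size (u : nat) p : u \in vertices -> path edge u p -> uniq (u :: p) ->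
  (size p).+1 < 2 ^ h.
Proof.
move=> uV ep up; apply: (@sorted_size h (u :: p)) => //; first exact: path_vertices.
by move=> x /(path_vertices uV ep) xV; have := dep_gt0 xV; lia.
Qed.

Lemma shorten_path (A : seq nat) (u v : nat) : {subset A <= vertices} -> v \in comp A u ->
  exists p, [/\ path edge u p, all (mem A) (u :: p), last u p = v & size p < 2 ^ h].
Proof.
move=> sAV /compP[p [ep Ap lp]]; exists (shorten u p).
have uV : u \in vertices by apply: sAV; case/andP: Ap.
case: (shortenP ep) lp => q eq uq sub lp; split=> //.
  apply/allP=> y; rewrite inE => /predU1P[->|/sub yp]; first by case/andP: Ap.
  by move/allP: Ap; apply; rewrite inE yp orbT.
by apply: ltnW; apply: path_size uV eq uq.
Qed.

(** The predecessor of a cap above 1 is positive and not stable, so some two vertices are at exactly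
    that distance; a duplicate-free path between them has fewer than [2 ^ h] vertices. *)
Lemma cap_bound d : cap M d <= 2 ^ h.
Proof.
case E: (cap M d) => [|i] //.
have lt : i < cap M d by rewrite E.
have := before_find 0 lt; rewrite nth_iota; last first.
  by apply: leq_trans lt _; rewrite -[X in _ <= X](size_iota 0); apply: find_size.
rewrite add0n; case: i E {lt} => [|i] E; first by rewrite expn_gt0.
rewrite /stable /= => /negbT/allPn[u uV /allPn[v nv nnv]].
have {}nv : near M i.+1 u v by [].
case/(nearP edge_sym edge_bound): nv => p [ep _ lp sp].
have /path_size : path edge u (shorten u p) by case: (shortenP ep).
move=> /(_ uV); case: (shortenP ep) lp => q eq uq sub lp /(_ uq) le.
suff lq : i < size q by apply: ltnW; apply: leq_ltn_trans le.
rewrite ltnNge; apply: contra nnv => lq.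
by apply/(nearP edge_sym edge_bound); exists q.
Qed.

(** A vertex [t] of least depth works: the top of a path from [t] to [x] lies in the component and
    is an ancestor of [t], hence is [t]. *)
Lemma comp_top (A : seq nat) u : {subset A <= vertices} -> u \in A ->
  exists2 t, t \in comp A u & forall x, x \in comp A u -> anc t x.
Proof.
move=> sAV uA.
(* Maximising [h - dep x] minimises the depth. *)
have [|t [tC _ mt]] := @seq_argmax (comp A u) (fun x => h - dep x) predT.
  by apply/hasP; exists u => //; apply: comp_refl.
exists t => // x xC.
have : x \in comp A t by apply: (comp_trans _ xC); apply: comp_sym.
case/compP=> p [ep Ap lp].
have tV : t \in vertices by apply: sAV; apply: comp_sub tC.
have [t' t'p ht] := path_top tV ep.
suff <- : t' = t by apply: ht; rewrite -lp mem_last.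
apply/eqP; apply: contraT => ne.
have lt : dep t' < dep t by apply: anc_dep ne; apply: ht; apply: mem_head.
have t'V : t' \in vertices by apply: path_vertices tV ep _ t'p.
have t'C : t' \in comp A u.
  apply: (comp_trans tC); case/splitPl: t'p ep Ap => p1 p2 l1.
  rewrite cat_path -cat_cons all_cat => /andP[ep1 _] /andP[Ap1 _].
  by apply/compP; exists p1.
have := mt t' t'C isT; have := dep_le t'V; have := dep_le tV; lia.
Qed.

(** ** Balanced separators *)

Lemma unbalanced_mono (W T T' : seq nat) :
  {subset T <= T'} -> unbalanced M W T -> unbalanced M W T'.
Proof.
move=> sub /hasP[u uT lt]; apply/hasP; exists u; first exact: sub.
apply: leq_trans lt _; rewrite !size_filter.
by apply: leq_add; apply: sub_count => w; apply: comp_mono.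
Qed.

(** One greedy pass suffices by monotonicity: a vertex was kept because its removal balanced a
    larger set, so its removal also balances the final one. *)
Lemma min_unbalancedP (W A : seq nat) : uniq A -> unbalanced M W A ->
  [/\ uniq (min_unbalanced M W A), {subset min_unbalanced M W A <= A},
      unbalanced M W (min_unbalanced M W A) &
      forall x, x \in min_unbalanced M W A ->
        ~~ unbalanced M W (minus (min_unbalanced M W A) [:: x])].
Proof.
move=> uA bA; rewrite /min_unbalanced.
set prune := fun T x => if unbalanced M W (minus T [:: x]) then minus T [:: x] else T.
suff H l : [/\ uniq (foldl prune A l), {subset foldl prune A l <= A},
   unbalanced M W (foldl prune A l) &
   forall x, x \in l -> x \in foldl prune A l ->
     ~~ unbalanced M W (minus (foldl prune A l) [:: x])].
  by have [u s b m] := H A; split=> // x xT; apply: m => //; apply: s.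
elim/last_ind: l => [|l y [u s b m]]; first by split.
rewrite foldl_rcons; set T := foldl _ _ _ in u s b m *; rewrite /prune.
case: ifP => by_; split=> //.
- exact: minus_uniq.
- by move=> x; rewrite mem_minus => /andP[/s].
- move=> x; rewrite mem_rcons inE mem_minus mem_seq1 => /predU1P[->|xl] /andP[xT xy].
    by rewrite eqxx in xy.
  apply: contra (m x xl xT); apply: unbalanced_mono => z.
  by rewrite !mem_minus => /andP[/andP[-> _] ->].
- by move=> x; rewrite mem_rcons inE => /predU1P[->|/m//]; rewrite by_.
Qed.

(** The union of the paths joining one vertex of [W] to the others in a component
    that is too heavy is unbalanced, hence contains every minimal unbalanced set. *)
Lemma min_unbalanced_size (W A : seq nat) : uniq A -> {subset A <= vertices} ->
  unbalanced M W A -> size (min_unbalanced M W A) <= size W * 2 ^ h.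
Proof.
move=> uA sAV bA; have [uT sT bT mT] := min_unbalancedP uA bA.
set T := min_unbalanced M W A in uT sT bT mT *.
have sTV : {subset T <= vertices} by move=> x /sT /sAV.
case/hasP: (bT) => u uT' lt.
(* Each path contributes at most [2 ^ h - 1] vertices besides [u]. The unit saved makes room for [u]
   itself, as at least one path is present. *)
have [Z [sZ hZ]] : exists Z, size Z <= count (mem (comp T u)) W * (2 ^ h).-1 /\
    forall w, w \in W -> w \in comp T u -> exists p, [/\ path edge u p, all (mem T) (u :: p),
      last u p = w & {subset p <= Z}].
  elim: (W) => [|w W' [Z [sZ hZ]]]; first by exists [::].
  case wC: (w \in comp T u); last first.
    exists Z; split; first by rewrite /= wC.
    move=> w'; rewrite inE => /predU1P[->|]; first by rewrite wC.
    exact: hZ.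
  have [p [ep Tp lp sp]] := shorten_path sTV wC; exists (p ++ Z); split.
    by rewrite size_cat /= wC mulnDl mul1n leq_add // -ltnS prednK // expn_gt0.
  move=> w'; rewrite inE => /predU1P[->|w'W' w'C].
    by exists p; split=> // x xp; rewrite mem_cat xp.
  have [q [eq Tq lq sq]] := hZ w' w'W' w'C; exists q; split=> // x /sq xZ.
  by rewrite mem_cat xZ orbT.
have sub : {subset T <= u :: Z}.
  move=> x xT; apply: contraT; rewrite inE negb_or => /andP[xu xZ].
  case/negP: (mT x xT); apply/hasP; exists u.
    by rewrite mem_minus uT' mem_seq1 eq_sym.
  apply: leq_trans lt _; rewrite !size_filter.
  suff le : count (mem (comp T u)) W <= count (mem (comp (minus T [:: x]) u)) W.
    by apply: leq_add.
  rewrite leq_eqVlt; apply/orP; left; apply/eqP; apply: eq_in_count => w wW.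
  apply/idP/idP; last by apply: comp_mono => z; rewrite mem_minus => /andP[].
  case/(hZ w wW) => p [ep Tp lp sp]; apply/compP; exists p; split=> //.
  apply/allP=> y yp; have yT : y \in T := allP Tp y yp.
  rewrite -[mem _ y]/(y \in _) mem_minus yT mem_seq1 /=.
  move: yp; rewrite inE => /predU1P[->|/sp yZ]; first by rewrite eq_sym.
  by apply: contraNneq xZ => <-.
have := uniq_leq_size uT sub; rewrite /= => le.
have cW : count (mem (comp T u)) W <= size W by apply: count_size.
have c0 : 0 < count (mem (comp T u)) W by move: lt; rewrite size_filter; case: count.
have p0 : 0 < 2 ^ h by rewrite expn_gt0.
apply: leq_trans le _; move: sZ cW c0 p0; move: (count _ _) (size Z) (size W) (2 ^ h).
move=> a b c [//|d] /=; nia.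
Qed.

(** Let [z] be a deepest node with more than half of [W] at or below it, and remove its ancestors,
    [z] included. The top [t] of a component that is still too heavy is again such a node. It is not
    an ancestor of [z], not below [z] by the choice of [z], and not incomparable, since two disjoint
    majorities of [W] do not exist. *)
Lemma separator_exists (W A : seq nat) : uniq A -> {subset A <= vertices} ->
  exists S, [/\ size S <= h, uniq S, {subset S <= A} & balances M W A S].
Proof.
move=> uA sAV; pose heavy x := size W < count (anc x) W + count (anc x) W.
have topheavy S u : u \in minus A S ->
    size W < size [seq w <- W | w \in comp (minus A S) u] + size [seq w <- W | w \in comp (minus A S) u] ->
    exists t, [/\ t \in minus A S & heavy t].
  move=> uS lt; have sub : {subset minus A S <= vertices}.
    by move=> x; rewrite mem_minus => /andP[/sAV].
  have [t tC ht] := comp_top sub uS; exists t; split; first exact: comp_sub tC.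
  apply: leq_trans lt _; rewrite !size_filter.
  by apply: leq_add; apply: sub_count => w /ht.
(* Without a heavy node no component is heavy, and the empty set separates. *)
case hv: (has heavy vertices); last first.
  exists [::]; split=> //; apply/hasPn => u uA'; apply/negP => /(topheavy _ _ uA')[t [tA tv]].
  move/negbT/hasPn: hv => /(_ t); rewrite tv => /(_ _)/negP; apply=> //.
  by apply: sAV; move: tA; rewrite mem_minus => /andP[].
have [z [zV zh zm]] := seq_argmax dep hv.
exists [seq x <- A | anc x z]; split.
(* The ancestors of [z] form a chain, so their depths are distinct numbers between 1 and [h]. *)
- rewrite -(size_map dep) -[X in _ <= X](size_iota 1); apply: uniq_leq_size.
    rewrite map_inj_in_uniq ?filter_uniq // => x y.
    rewrite !mem_filter => /andP[xz xA] /andP[yz yA] e.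
    apply/eqP; apply: contraT => ne.
    case: (anc_linear xz yz) => [/anc_dep/(_ ne)|/anc_dep]; first by rewrite e ltnn.
    by rewrite eq_sym ne e ltnn => /(_ isT).
  move=> d /mapP[x]; rewrite mem_filter => /andP[xz xA] ->; rewrite mem_iota.
  have xV := sAV x xA; have := dep_gt0 xV; have := dep_le xV; lia.
- exact: filter_uniq.
- by move=> x; rewrite mem_filter => /andP[].
apply/hasPn => u uA'; apply/negP => /(topheavy _ _ uA')[t []].
rewrite mem_minus mem_filter negb_and => /andP[tA]; rewrite tA orbF => ntz th.
have tV := sAV t tA.
case zt: (anc z t).
  have ne : z != t by apply: contraNneq ntz => <-; apply: anc_refl.
  by have := anc_dep zt ne; rewrite ltnNge zm.
have : count (anc t) W + count (anc z) W <= size W.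
  rewrite -count_predUI -(count_predT W) (@eq_count _ (predI (anc t) (anc z)) pred0).
    by rewrite count_pred0 addn0 count_predT count_size.
  move=> w /=; apply/negP => /andP[tw zw].
  by case: (anc_linear tw zw); rewrite ?zt ?(negbTE ntz).
by move: th zh; rewrite /heavy; lia.
Qed.

(** The last clause ties the number of unsuccessful rounds to the size of the candidates, so that
    after [size M] rounds only success is possible. The bound on the list holds at every round, as
    the timing requires. *)
Lemma separators_inv (W A : seq nat) i : uniq A -> {subset A <= vertices} ->
  exists s, [/\ s <= h,
    forall X, X \in iter i (separator_step M W A) [:: [::]] ->
      [/\ size X = s, uniq X & {subset X <= A}],
    size (iter i (separator_step M W A) [:: [::]]) <= (size W * 2 ^ h) ^ s &
    has (balances M W A) (iter i (separator_step M W A) [:: [::]]) \/ i = s /\ i < size M].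
Proof.
move=> uA sAV; have [S [Sh uS SA bS]] := separator_exists W uA sAV.
have SM : size S <= size M.
  by rewrite -[size M](size_iota 0); apply: uniq_leq_size => // x /SA /sAV.
(* The stronger invariant follows one candidate inside the unknown separator [S]: it grows in every
   unsuccessful round, so there are at most [size S] of them. *)
suff [s [lesh LX sL st]] : exists s, [/\ s <= h,
    forall X, X \in iter i (separator_step M W A) [:: [::]] ->
      [/\ size X = s, uniq X & {subset X <= A}],
    size (iter i (separator_step M W A) [:: [::]]) <= (size W * 2 ^ h) ^ s &
    has (balances M W A) (iter i (separator_step M W A) [:: [::]]) \/
    [/\ i = s, s < size S & exists2 X, X \in iter i (separator_step M W A) [:: [::]] &
       {subset X <= S}]].
  exists s; split=> //; case: st => [|[-> lt _]]; [by left|right; split=> //].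
  exact: leq_trans lt SM.
(* A candidate inside [S] that is as large as [S] has the same elements and therefore balances. *)
have full (L : seq (seq nat)) (X : seq nat) : uniq X -> X \in L -> {subset X <= S} ->
    ~~ has (balances M W A) L -> size X < size S.
  move=> uX XL XS /hasPn nb; rewrite ltnNge; apply/negP => le.
  have [_ eqX] := uniq_min_size uX XS le.
  case/negP: (nb X XL); move: bS; rewrite /balances.
  rewrite (_ : minus A X = minus A S) //; apply: eq_filter => x.
  by rewrite eqX.
elim: i => [|i [s [lesh LX sL st]]].
  exists 0; split=> //=; first by move=> X; rewrite inE => /eqP->.
  case b: (balances M W A [::]); [by left|right].
  split=> //; last by exists [::].
  by apply: (full [:: [::]] [::]) => //=; rewrite b.
rewrite iterS; set L := iter i _ _ in LX sL st *; rewrite /separator_step.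
case: ifP => hb; first by exists s; split=> //; left.
case: st => [|[eis lt [X XL XS]]]; first by rewrite hb.
have exp Y : Y \in expand M W A L <-> exists X t,
    [/\ X \in L, t \in min_unbalanced M W (minus A X) & Y = t :: X].
  split; first by case/flattenP=> l /mapP[X' X'L ->] /mapP[t tT ->]; exists X', t.
  case=> X' [t [X'L tT ->]]; apply/flattenP.
  exists [seq t :: X' | t <- min_unbalanced M W (minus A X')]; first by apply/mapP; exists X'.
  by apply/mapP; exists t.
have unb X' : X' \in L -> unbalanced M W (minus A X').
  by move=> X'L; move/negbT/hasPn: hb => /(_ _ X'L); rewrite negbK.
have mP X' (X'L : X' \in L) := min_unbalancedP (minus_uniq X' uA) (unb X' X'L).
have LX' Y : Y \in expand M W A L -> [/\ size Y = s.+1, uniq Y & {subset Y <= A}].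
  case/exp=> X' [t [X'L tT ->]]; have [sX uX XA] := LX _ X'L.
  have [_ sub _ _] := mP _ X'L; have := sub _ tT; rewrite mem_minus => /andP[tA tX].
  split=> /=; [by rewrite sX|by rewrite tX|].
  by move=> x; rewrite inE => /predU1P[->|/XA].
exists s.+1; split=> //.
- exact: leq_trans lt Sh.
- rewrite expnS mulnC; apply: (@leq_trans (size L * (size W * 2 ^ h))); last first.
    by rewrite leq_mul2r sL orbT.
  have sz X' : X' \in L -> size (min_unbalanced M W (minus A X')) <= size W * 2 ^ h.
    move=> X'L; apply: min_unbalanced_size; [exact: minus_uniq| |exact: unb].
    by move=> x; rewrite mem_minus => /andP[/sAV].
  rewrite /expand; elim: (L) sz => //= X' L' IH sz.
  rewrite size_cat size_map mulSn leq_add ?sz ?mem_head // IH // => Y YL.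
  by apply: sz; rewrite inE YL orbT.
case hb': (has (balances M W A) (expand M W A L)); [by left|right].
have [_ sub bT _] := mP _ XL.
have [t tT tS] : exists2 t, t \in min_unbalanced M W (minus A X) & t \in S.
  apply/hasP; apply: contraT => /hasPn nS; move: bS; rewrite /balances => /negP; case.
  apply: unbalanced_mono bT => x xT; rewrite mem_minus nS // andbT.
  by have := sub _ xT; rewrite mem_minus => /andP[].
have YL : t :: X \in expand M W A L by apply/exp; exists X, t.
have YS : {subset t :: X <= S} by move=> x; rewrite inE => /predU1P[->|/XS].
split; [by rewrite eis| |by exists (t :: X)].
by have [sY uY _] := LX' _ YL; rewrite -sY; apply: full YL YS (negbT hb').
Qed.

Lemma separatorP (W A : seq nat) : uniq A -> {subset A <= vertices} ->
  [/\ size (separator M W A) <= h, uniq (separator M W A) & balances M W A (separator M W A)].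
Proof.
move=> uA sAV; have [s [lesh LX _ [hb|[_]]]] := separators_inv W (size M) uA sAV; last by rewrite ltnn.
rewrite /separator /separators; set L := iter _ _ _ in LX hb *.
have : head [::] [seq X <- L | balances M W A X] \in [seq X <- L | balances M W A X].
  by move: hb; rewrite has_filter; case: filter => //= *; rewrite mem_head.
by rewrite mem_filter => /andP[b /LX[sX u _]]; rewrite sX.
Qed.

(** ** Width of the elimination order *)

Definition width_le (X : seq nat) k :=
  forall u, u \in minus vertices X -> size (nbrs (comp (minus vertices X) u)) <= k.

Lemma nbrs_comp (X : seq nat) u y :
  y \in nbrs (comp (minus vertices X) u) -> y \in X.
Proof.
move=> yN; have yV := nbrs_sub yN.
case/(nbrsP edge_sym edge_bound): yN => yC [c cC cy].
apply: contraT => yX; case/negP: yC; apply: comp_edge cC cy _.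
by rewrite mem_minus yV.
Qed.

Section Extend.
Variables (X : seq nat) (u : nat).
Hypothesis X_width : width_le X h.*2.+2.
Hypothesis u_new : u \in minus vertices X.
Let C := comp (minus vertices X) u.
Let W := nbrs C.
Let S := separator M W (C ++ W).
Let N := next_vertices M X u.

Let C_sub : {subset C <= vertices}.
Proof. by move=> x /comp_sub; rewrite mem_minus => /andP[]. Qed.

Let C_notX x : x \in C -> x \notin X.
Proof. by move=> /comp_sub; rewrite mem_minus => /andP[]. Qed.

Let CW_sub : {subset C ++ W <= vertices}.
Proof. by move=> x; rewrite mem_cat => /orP[/C_sub|/nbrs_sub]. Qed.

Let CW_uniq : uniq (C ++ W).
Proof.
rewrite cat_uniq comp_uniq ?nbrs_uniq ?andbT /=; last exact/minus_uniq/iota_uniq.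
by apply/hasPn => x /(nbrsP edge_sym edge_bound)[].
Qed.

Let N_C : {subset N <= C}.
Proof. by move=> x; rewrite mem_filter => /andP[]. Qed.

Let mem_N x : x \in N = (x \in C) && ((x == u) || (x \in S)).
Proof. by rewrite mem_filter andbC. Qed.

Let W_size : size W <= h.*2.+2.
Proof. exact: X_width u_new. Qed.

Lemma next_vertices_size : size N <= h.+1.
Proof.
have [sS _ _] := separatorP W CW_uniq CW_sub.
apply: leq_trans (uniq_leq_size (next_vertices_uniq M X u) (_ : {subset _ <= u :: S})) _ => //.
by move=> x; rewrite [x \in _]mem_N inE => /andP[].
Qed.

Lemma subcomp (Y : seq nat) x : {subset comp (minus vertices (Y ++ X)) x <= comp (minus vertices X) x}.
Proof.
move=> z; apply: comp_mono => z'; rewrite !mem_minus mem_cat negb_or.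
by case/and3P=> -> _ ->.
Qed.

Lemma nbrs_subcomp (Y : seq nat) x y : x \in C ->
  y \in nbrs (comp (minus vertices (Y ++ X)) x) -> y \in Y \/ y \in W.
Proof.
move=> xC yN; have := nbrs_comp yN; rewrite mem_cat => /orP[|yX]; [by left|right].
case/(nbrsP edge_sym edge_bound): yN => _ [c cx cy].
apply/(nbrsP edge_sym edge_bound); split; first by apply/negP => /C_notX; rewrite yX.
by exists c => //; apply: (comp_trans xC); apply: subcomp cx.
Qed.

(** A component outside [C] has no neighbour in [C], so vertices chosen in [C] do not affect it. *)
Lemma width_other (Y : seq nat) x : {subset Y <= C} -> x \in minus vertices (Y ++ X) ->
  x \notin C -> size (nbrs (comp (minus vertices (Y ++ X)) x)) <= h.*2.+2.
Proof.
move=> YC; rewrite mem_minus mem_cat negb_or => /and3P[xV xY xX] xC.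
have xm : x \in minus vertices X by rewrite mem_minus xV.
apply: leq_trans (X_width xm); apply: uniq_leq_size; first exact: nbrs_uniq.
move=> y yN; have := nbrs_comp yN; rewrite mem_cat.
case/(nbrsP edge_sym edge_bound): (yN) => _ [c cx cy] /orP[yY|yX].
  case/negP: xC; apply: (comp_trans (YC y yY)); apply: comp_sym => //.
  apply: (comp_edge (subcomp cx) cy); rewrite mem_minus C_notX ?(YC y) // andbT.
  exact: C_sub (YC _ yY).
apply/(nbrsP edge_sym edge_bound); split; last by exists c => //; apply: subcomp cx.
by apply/negP => /comp_sub; rewrite mem_minus yX andbF.
Qed.

Lemma width_extend_part (Y : seq nat) : uniq Y -> {subset Y <= N} ->
  width_le (Y ++ X) (3 * h + 3).
Proof.
move=> uY YN x xm.
case xC : (x \in C); last first.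
  by apply: leq_trans (width_other _ xm (negbT xC)) _; [move=> y /YN /N_C|lia].
apply: (@leq_trans (size (Y ++ W))).
  apply: uniq_leq_size; first exact: nbrs_uniq.
  by move=> y /(nbrs_subcomp xC)[] yY; rewrite mem_cat yY ?orbT.
rewrite size_cat; apply: (@leq_trans (h.+1 + h.*2.+2)); last by lia.
apply: leq_add W_size; exact: leq_trans (uniq_leq_size uY YN) next_vertices_size.
Qed.

(** The neighbours of a new component in [C] belong to [u :: S] or to the part of [W] in the same
    component of [C ++ W] without [S]; each of the two contributes at most [h + 1]. *)
Lemma width_extend : width_le (N ++ X) h.*2.+2.
Proof.
move=> x xm; case xC : (x \in C); last exact: width_other xm (negbT xC).
have [sS _ bS] := separatorP W CW_uniq CW_sub.
set C' := comp (minus vertices (N ++ X)) x.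
have C'C : {subset C' <= C} by move=> z zC; apply: (comp_trans xC); apply: subcomp zC.
have C'S : {subset C' <= minus (C ++ W) S}.
  move=> z zC; rewrite mem_minus mem_cat C'C //=.
  have := comp_sub zC; rewrite mem_minus mem_cat mem_N C'C //= => /andP[_].
  by rewrite !negb_or => /andP[/andP[]].
have xC' : x \in C' by apply: comp_refl.
have C'c : {subset C' <= comp (minus (C ++ W) S) x}.
  move=> z /compP[p [ep Ap lp]]; apply/compP; exists p; split=> //.
  apply/allP=> y yp; apply: C'S.
  case/splitPl: yp ep Ap => p1 p2 l1; rewrite cat_path -cat_cons all_cat.
  by move=> /andP[ep1 _] /andP[Ap1 _]; apply/compP; exists p1.
apply: (@leq_trans (size ((u :: S) ++ [seq w <- W | w \in comp (minus (C ++ W) S) x]))).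
  apply: uniq_leq_size; first exact: nbrs_uniq.
  move=> y yN; rewrite mem_cat inE mem_filter.
  case: (nbrs_subcomp xC yN) => [|yW]; first by rewrite mem_N => /andP[_ ->].
  case yS : (y \in S); first by rewrite orbT.
  apply/orP; right; rewrite yW andbT.
  case/(nbrsP edge_sym edge_bound): (yN) => _ [c cx cy].
  by apply: (comp_edge (C'c _ cx) cy); rewrite mem_minus mem_cat yW orbT yS.
move/hasPn: bS => /(_ x (C'S _ xC')); rewrite -leqNgt addnn => /leq_trans/(_ W_size).
rewrite -doubleS leq_double => le; rewrite size_cat -addnn; exact: leq_add.
Qed.

End Extend.

(** Batches are put in front and elimination starts at the front, so the vertices not yet eliminated
    always form a suffix: a part of one batch followed by all earlier ones. *)
Lemma width_iter i : width_le (iter i (extend M) [::]) h.*2.+2 /\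
  forall j, width_le (drop j (iter i (extend M) [::])) (3 * h + 3).
Proof.
have w0 : forall k, width_le [::] k.
  move=> k u _; suff -> : nbrs (comp (minus vertices [::]) u) = [::] by [].
  by case E: nbrs => [|y s] //; have := @nbrs_comp [::] u y; rewrite E mem_head => /(_ isT).
elim: i => [|i [w IH]]; first by split=> // j; case: j.
rewrite iterS; set X := iter i _ _ in w IH *; rewrite /extend.
case E: (minus vertices X) => [|u s]; first by split.
have um : u \in minus vertices X by rewrite E mem_head.
split; first exact: width_extend.
move=> j; rewrite drop_cat; case: ifP => // _.
apply: (width_extend_part w um); first exact/drop_uniq/next_vertices_uniq.
by move=> x; apply: mem_drop.
Qed.

(** ** Table sizes *)

Lemma table_size r C B T : exact M r C B T -> uniq T -> {subset C <= vertices} ->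
  size T <= r.+1 ^ size B * (size M).+1.
Proof.
move=> ex uT CV.
(* On entries of [T] no use of [inord] falls back to its default: distances are at most [r] and
   sizes at most [size M]. *)
pose g (x : seq nat * nat) := ([ffun i : 'I_(size B) => inord (nth 0 x.1 (nth 0 B i)) : 'I_r.+1],
  inord x.2 : 'I_(size M).+1).
have -> : r.+1 ^ size B * (size M).+1 = #|{: {ffun 'I_(size B) -> 'I_r.+1} * 'I_(size M).+1}|.
  by rewrite card_prod card_ffun !card_ord.
have inj : {in T &, injective g}.
  move=> [f s] [f' s'] /ex[K [uK KC _ -> ->]] /ex[K' [uK' K'C _ -> ->]] [/ffunP eqf eqs].
  have szK (L : seq nat) : uniq L -> {subset L <= C} -> size L < (size M).+1.
    move=> uL LC; rewrite ltnS -[size M](size_iota 0).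
    by apply: uniq_leq_size => // x /LC /CV.
  congr (_, _); last first.
    by have /(congr1 val) := eqs; rewrite /= !inordK //; apply: szK.
  apply/eq_in_map => x; rewrite mem_vertices => xn; case: ifP => // xB.
  have lt : index x B < size B by rewrite index_mem.
  have := eqf (Ordinal lt); rewrite !ffunE /= nth_index // => /(congr1 val).
  by rewrite /= !nth_profile xn xB /= !inordK // ltnS mins_le.
rewrite -(size_map g) -(card_uniqP _) ?max_card // map_inj_in_uniq //.
Qed.

(** A nonempty piece is a component of the graph without a suffix of the order, to which
    [width_iter] applies. *)
Lemma piece_nbrs_size r i p :
  p \in foldl (eliminate M r) [::] (take i (elimination_order M)) ->
  size (nbrs p.1.1) <= 3 * h + 3.
Proof.
have [ok uF eqU] := elimination_order_ok edge_sym edge_bound r i.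
move=> pps; have [E ex sub nU cn] := ok p pps.
case EC : p.1.1 => [|x C'].
  suff -> : nbrs [::] = [::] by [].
  case EN: nbrs => [|y s] //; have : y \in nbrs [::] by rewrite EN mem_head.
  by case/(nbrsP edge_sym edge_bound) => _ [].
rewrite -EC; have xC : x \in p.1.1 by rewrite EC mem_head.
set U := rev _ in ok uF eqU E ex sub nU cn.
have eqm : U =i minus vertices (drop i (elimination_order M)).
  move=> y; rewrite mem_minus mem_rev -mem_elimination_order.
  have := elimination_order_uniq M.
  rewrite -{1 3}(cat_take_drop i (elimination_order M)) cat_uniq mem_cat.
  case/and3P=> _ /hasPn h1 _; case yt: (y \in take i _) => /=.
    by apply/esym/negP => /h1 /=; rewrite yt.
  by rewrite andbN.
have eqC : p.1.1 =i comp (minus vertices (drop i (elimination_order M))) x.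
  move=> y; apply/idP/idP => [yC|].
    by apply: comp_mono (cn x y xC yC) => z; rewrite eqm.
  apply: comp_closed => // a b aC ab; rewrite -eqm => bU; apply: contraT => bC.
  have := nU b; rewrite bU E => /(_ _); apply; apply/(nbrsP edge_sym edge_bound).
  by split=> //; exists a.
have -> : nbrs p.1.1 = nbrs (comp (minus vertices (drop i (elimination_order M))) x).
  by apply: eq_filter => y; rewrite eqC (eq_has_r eqC).
have [_ w] := width_iter (size M); apply: w.
by rewrite -eqm; apply: sub.
Qed.

End TreeDepth.

(** * Instances *)

Definition matrix (G : graph) : seq (seq bool) :=
  [seq [seq adj i j | j <- enum 'I_(Defs.order G)] | i <- enum 'I_(Defs.order G)].

(** A negative [d] or [k] imposes no condition, exactly like 0. *)
Definition nat_of_int (z : int) : nat := if (z < 0)%R then 0 else `|z|%N.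

Section Matrix.
Variable G : graph.
Local Notation n := (Defs.order G).
Local Notation M := (matrix G).

Lemma size_matrix : size M = n.
Proof. by rewrite size_map size_enum_ord. Qed.

Lemma edge_adj (i j : 'I_n) : edge M i j = adj i j.
Proof.
rewrite /edge (nth_map i) ?size_enum_ord // (nth_map j) ?size_enum_ord //.
by rewrite !nth_ord_enum.
Qed.

Lemma edge_ord u v : edge M u v -> exists i j : 'I_n, [/\ u = i, v = j & adj i j].
Proof.
move=> e; have un : u < n.
  rewrite ltnNge; apply/negP => le; move: e; rewrite /edge [nth [::] _ _]nth_default ?nth_nil //.
  by rewrite size_matrix.
have vn : v < n.
  rewrite ltnNge; apply/negP => le; move: e.
  by rewrite /edge (nth_map (Ordinal un)) ?size_enum_ord // nth_default // size_map size_enum_ord.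
by exists (Ordinal un), (Ordinal vn); split=> //; rewrite -edge_adj.
Qed.

Lemma matrix_sym : symmetric (edge M).
Proof.
have imp u v : edge M u v -> edge M v u.
  by case/edge_ord=> i [j [-> ->]]; rewrite edge_adj adj_sym.
by move=> u v; apply/idP/idP; apply: imp.
Qed.

Lemma matrix_bound u v : edge M u v -> u < size M.
Proof. by case/edge_ord=> i [j [-> _ _]]; rewrite size_matrix. Qed.

Lemma near_walk i (u v : 'I_n) :
  near M i u v <-> exists2 m, m <= i & walk_of_length (@adj G) u v m.
Proof.
split.
  case/(nearP matrix_sym matrix_bound)=> p [ep _ lp sp]; exists (size p) => //.
  have [q qp] : exists q : seq 'I_n, p = map val q.
    elim: p (val u) ep {lp sp} => [|y p IH] x /=; first by exists [::].
    by case/andP=> /edge_ord[_ [j [_ -> _]]] /IH[q ->]; exists (j :: q).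
  subst p; rewrite size_map; apply/existsP; exists (in_tuple q) => /=.
  move: ep; rewrite path_map (eq_path (e' := @adj G)) => [-> /=|x y]; last exact: edge_adj.
  by move/eqP: lp; rewrite last_map (inj_eq val_inj).
case=> m mi /existsP[p /andP[ep /eqP lp]]; apply/(nearP matrix_sym matrix_bound).
exists (map val p); rewrite size_map size_tuple last_map lp path_map; split=> //.
  by rewrite (eq_path (e' := @adj G)) // => x y; apply: edge_adj.
by rewrite mem_vertices size_matrix.
Qed.

Lemma dist_at_leastP (d : int) (u v : 'I_n) :
  dist_at_least (@adj G) d u v <-> (forall i, i < nat_of_int d -> ~~ near M i u v).
Proof.
rewrite /dist_at_least /dist; case: {-}_ / idP => [uv|nuv]; last first.
  split=> // _ i _; apply/negP => /near_walk[m _ /existsP[p /andP[ep /eqP lp]]].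
  by apply: nuv; apply/connectP; exists p.
case: ex_minnP => m wm mm; split=> [le i lt|H].
  apply/negP => /near_walk[m' le' /mm le'']; move: lt le; rewrite /nat_of_int.
  by case: ifP => //; lia.
have nm : near M m u v by apply/near_walk; exists m.
apply: contraT => lt; suff lt' : m < nat_of_int d by have := H m lt'; rewrite nm.
by move: lt; rewrite /nat_of_int; case: ifP; lia.
Qed.

Lemma has_scattered_setP (d k : int) : has_scattered_set G d k <->
  exists K : seq nat, [/\ uniq K, {subset K <= vertices M},
    forall u v, u \in K -> v \in K -> u != v ->
      forall i, i < nat_of_int d -> ~~ near M i u v & nat_of_int k <= size K].
Proof.
split.
  case/existsP=> K /andP[kK /'forall_implyP sc]; exists (map val (enum K)); split.
  - by rewrite map_inj_uniq ?enum_uniq //; apply: val_inj.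
  - by move=> x /mapP[i _ ->]; rewrite mem_vertices size_matrix; apply: ltn_ord.
  - move=> _ _ /mapP[i + ->] /mapP[j + ->]; rewrite !mem_enum => iK jK ij.
    apply/dist_at_leastP; move/forallP/(_ j): (sc i iK).
    by rewrite jK /= => /implyP; apply; apply: contraNneq ij => ->.
  - by rewrite size_map -cardE; move: #|K| kK => c; rewrite /nat_of_int; case: ifP; lia.
case=> K [uK KV sc kK].
have [L EL] : exists L : seq 'I_n, K = map val L.
  elim: (K) KV => [|x K' IH] KV; first by exists [::].
  have [|L ->] := IH; first by move=> y yK; apply: KV; rewrite inE yK orbT.
  have xn : x < n by rewrite -size_matrix -mem_vertices KV ?mem_head.
  by exists (Ordinal xn :: L).
subst K; have uL : uniq L by rewrite -(map_inj_uniq val_inj).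
apply/existsP; exists [set x in L]; apply/andP; split.
  rewrite cardsE (card_uniqP uL); move: kK; rewrite size_map; move: (size L) => c.
  by rewrite /nat_of_int; case: ifP; lia.
apply/forall_inP => i; rewrite inE => iL; apply/forall_inP => j; rewrite inE => jL.
apply/implyP => ij; apply/dist_at_leastP; apply: sc; rewrite ?map_f //.
Qed.

End Matrix.

(** ** The forest order *)

Section ForestOrder.
Variable F : rooted_forest.
Implicit Types x y z : F.

Lemma depth_gt0 x : 0 < depth x.
Proof. by rewrite /depth; case: ex_minnP => -[]. Qed.

Lemma depth_parent x y : parent x = Some y -> depth x = (depth y).+1.
Proof.
move=> xy; rewrite /depth; case: ex_minnP => -[|m] // Hm mm; case: ex_minnP => m' Hm' mm'.
move: Hm; rewrite iterSr /= xy => /mm' le; apply/eqP; rewrite eqSS eqn_leq le andbT.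
by rewrite -ltnS; apply: mm; rewrite iterSr /= xy.
Qed.

Lemma ancestor_depth x y : ancestor x y -> x != y -> depth x < depth y.
Proof.
case/connectP=> p; elim: p y => [|z p IH] y /=; first by move=> _ ->; rewrite eqxx.
case/andP=> /eqP yz ep lp _; rewrite (depth_parent yz) ltnS.
by case: (eqVneq x z) => [->//|ne]; apply: ltnW; apply: IH.
Qed.

(** Parents are unique, so of the two chains starting at [z] one is a prefix of the other. *)
Lemma ancestor_linear x y z : ancestor x z -> ancestor y z -> ancestor x y \/ ancestor y x.
Proof.
case/connectP=> p; elim: p z => [|z' p IH] z /=; first by move=> _ ->; right.
case/andP=> /eqP zz' ep lp yz; case/connectP: (yz) => -[|z'' q] /=.
  move=> _ ->; left; apply/connectP; exists (z' :: p) => //=.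
  by rewrite zz' eqxx.
case/andP=> /eqP; rewrite zz' => -[<-] eq lq; apply: (IH z') => //.
by apply/connectP; exists q.
Qed.

End ForestOrder.

Lemma treedepth_order (G : graph) (h := treedepth G) (V := vertices (matrix G)) :
  exists anc : rel nat, exists dep : nat -> nat,
  [/\ forall x, x \in V -> anc x x, transitive anc,
      forall x y z, anc x z -> anc y z -> anc x y \/ anc y x,
      forall x y, anc x y -> x != y -> dep x < dep y &
      [/\ forall x, x \in V -> 0 < dep x, forall x, x \in V -> dep x <= h &
          forall x y, edge (matrix G) x y -> anc x y \/ anc y x]].
Proof.
rewrite /h /treedepth; case: ex_minnP => {}h /asboolP[F <- [f injf ef]] _.
pose n := Defs.order G.
(* Numbers that are not vertices are related to nothing, and forest nodes that carry no vertex are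
   forgotten. *)
pose anc x y := if (insub x, insub y) is (Some i, Some j) then
  ancestor (f (i : 'I_n)) (f (j : 'I_n)) else false.
pose dep x := if insub x is Some i then depth (f (i : 'I_n)) else 0.
have ord x : x \in V -> exists i : 'I_n, x = i.
  by rewrite mem_vertices size_matrix => lt; exists (Ordinal lt).
have ancE (i j : 'I_n) : anc i j = ancestor (f i) (f j) by rewrite /anc !valK.
have depE (i : 'I_n) : dep i = depth (f i) by rewrite /dep valK.
have ancP x y : anc x y -> exists i j : 'I_n, [/\ x = i, y = j & ancestor (f i) (f j)].
  rewrite /anc; case: insubP => //= i _ <-; case: insubP => //= j _ <- a.
  by exists i, j.
exists anc, dep; split.
- by move=> x /ord[i ->]; rewrite ancE; apply: connect0.
- move=> y x z /ancP[i [j [-> -> ij]]] /ancP[j' [k [/val_inj <- -> jk]]].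
  by rewrite ancE; apply: connect_trans jk ij.
- move=> x y z /ancP[i [k [-> -> ik]]] /ancP[j [k' [-> /val_inj kk' jk]]].
  by rewrite !ancE; rewrite -kk' in jk; apply: ancestor_linear ik jk.
- move=> x y /ancP[i [j [-> -> ij]]] ne; rewrite !depE; apply: ancestor_depth ij _.
  by rewrite (inj_eq injf).
split.
- by move=> x /ord[i ->]; rewrite depE depth_gt0.
- by move=> x /ord[i ->]; rewrite depE; apply: leq_bigmax.
- move=> x y /edge_ord[i [j [-> -> /ef]]]; rewrite !ancE => /andP[_ /orP[]]; by [left|right].
Qed.

(** ** Reading truncated numbers *)

(** Truncation at every digit keeps the unary accumulator below [c], although the number may be
    exponential in the number of its digits. *)
Definition read_nat (c : nat) (b : seq bool) :=
  foldl (fun acc x => minn c (if x then (acc + acc).+1 else acc + acc)) 0 (rev b).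

Lemma read_natE c n : read_nat c (bits n) = minn c n.
Proof.
have H l m : m < 2 ^ l -> read_nat c (mkseq (fun i => odd (m %/ 2 ^ i)) l) = minn c m.
  rewrite /read_nat foldl_rev; elim: l m => [|l IH] m.
    by rewrite expn0 ltnS leqn0 => /eqP->; rewrite minn0.
  move=> lt; have -> : mkseq (fun i => odd (m %/ 2 ^ i)) l.+1 =
      odd m :: mkseq (fun i => odd (m./2 %/ 2 ^ i)) l.
    rewrite /mkseq /= divn1; congr cons; rewrite -[1]addn0 iotaDl -map_comp.
    by apply: eq_map => i /=; rewrite add1n expnS divnMA divn2.
  rewrite /= IH; last by rewrite expnS in lt; lia.
  by have := odd_double_half m; case: (odd m) => /=; lia.
by apply: H; apply: trunc_log_ltn.
Qed.

Definition read_int c (z : bool * seq bool) := if z.1 then 0 else read_nat c z.2.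

Definition code_int (z : int) : bool * seq bool := ((z < 0)%R, bits `|z|%N).

Lemma read_intE c z : read_int c (code_int z) = minn c (nat_of_int z).
Proof.
by rewrite /read_int /nat_of_int /=; case: ifP => _; rewrite ?minn0 // read_natE.
Qed.

(** Truncating at one more than the number of vertices is harmless: finite distances and set sizes
    stay below it. *)
Definition solve (M : seq (seq bool)) d k :=
  answer M (read_int (size M).+1 d) (read_int (size M).+1 k).

Lemma solveE G d k : solve (matrix G) (code_int d) (code_int k) = has_scattered_set G d k.
Proof.
have sym := @matrix_sym G; have bnd := @matrix_bound G.
apply/idP/idP.
  case/(answerP sym bnd) => K [uK KV sc kK]; apply/has_scattered_setP; exists K; split=> //.
    move=> u v uu vK uv i lt; apply/negP => nr.
    (* A walk can be shortened to at most [size M - 1] edges, which is below the truncation of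
       [d]. *)
    have := sc u v uu vK uv (minn i (size (matrix G)).-1); rewrite read_intE.
    have -> : near (matrix G) (minn i (size (matrix G)).-1) u v.
      by rewrite minnC /minn; case: ifP => // _; apply: (near_size sym bnd) nr.
    by move=> /(_ ltac:(lia)).
  have : size K <= size (vertices (matrix G)) by apply: uniq_leq_size.
  by move: kK; rewrite read_intE size_iota; move: (size K) => s; lia.
case/has_scattered_setP => K [uK KV sc kK]; apply/(answerP sym bnd).
exists K; split=> //; last by rewrite read_intE; apply: leq_trans (geq_minr _ _) kK.
move=> u v uu vK uv i; rewrite read_intE => lt; apply: sc => //.
exact: leq_trans lt (geq_minr _ _).
Qed.

(** * Computability of the algorithm *)

Ltac computes_hyp :=
  match goal with
  | H : computes _ _ |- _ =>
    first [exact H | exact (computes_ctx _ H) | exact (computes_ctx _ (computes_ctx _ H))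
          | exact (computes_ctx _ (computes_ctx _ (computes_ctx _ H)))
          | exact (computes_ctx _ (computes_ctx _ (computes_ctx _ (computes_ctx _ H))))]
  end.

(** A hook, redefined below whenever further functions of the algorithm have been shown
    computable. *)
Ltac computes_user := fail.

Ltac computes_step := cbv beta;
  lazymatch goal with
  | |- computes _ (fun x => x) => apply: computes_id
  | |- computes _ fst => exact: (computes_fst (computes_id _))
  | |- computes _ snd => exact: (computes_snd (computes_id _))
  | |- computes _ (fun _ => ?b) => apply: computes_const
  | |- computes _ (fun x => fst (@?f x)) => first [computes_hyp | apply: computes_fst]
  | |- computes _ (fun x => snd (@?f x)) => first [computes_hyp | apply: computes_snd]
  | |- computes _ (fun x => (@?f x, @?g x)) => apply: computes_pair
  | |- computes _ (fun x => cons (@?f x) (@?g x)) => apply: computes_cons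
  | |- computes _ (fun x => ~~ (@?b x)) => apply: computes_neg
  | |- computes _ (fun x => (@?b x) && (@?c x)) => apply: computes_and
  | |- computes _ (fun x => (@?b x) || (@?c x)) => apply: computes_or
  | |- computes _ (fun x => S (@?b x)) => apply: computes_succ
  | |- computes _ (fun x => (@?b x).-1) => apply: computes_pred
  | |- computes _ (fun x => @?b x + @?c x) => apply: computes_add
  | |- computes _ (fun x => @?b x - @?c x) => apply: computes_sub
  | |- computes _ (fun x => @?b x <= @?c x) => apply: computes_leq
  | |- computes _ (fun x => minn (@?b x) (@?c x)) => apply: computes_min
  | |- computes _ (fun x => @?b x == @?c x) =>
      first [apply: computes_eqn | apply: computes_eq_seq]
  | |- computes _ (fun x => @?b x \in @?c x) => apply: computes_memn
  | |- computes _ (fun x => rev (@?b x)) => apply: computes_rev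
  | |- computes _ (fun x => size (@?b x)) => apply: computes_size
  | |- computes _ (fun x => flatten (@?b x)) => apply: computes_flatten
  | |- computes _ (fun x => head (@?b x) (@?c x)) => apply: computes_head
  | |- computes _ (fun x => (@?b x) ++ (@?c x)) => apply: computes_cat
  | |- computes _ (fun x => iota 0 (@?b x)) => apply: computes_iota0
  | |- computes _ (fun x => nth (@?b x) (@?c x) (@?d x)) => apply: computes_nth
  | |- computes _ (fun x => has (@?b x) (@?c x)) => apply: computes_has
  | |- computes _ (fun x => all (@?b x) (@?c x)) => apply: computes_all
  | |- computes _ (fun x => find (@?b x) (@?c x)) => apply: computes_find
  | |- computes _ (fun x => filter (@?b x) (@?c x)) => apply: computes_filter
  | |- computes _ (fun x => map (@?b x) (@?c x)) => apply: computes_map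
  | |- _ => first [computes_hyp | apply: computes_if | computes_user]
  end.

Ltac computing := repeat computes_step.

Section Poly.
Context {A : Type} {EA : Enc A}.
Variables (m : A -> nat) (M : A -> seq (seq bool)).
Hypothesis HM : computes m M.

Lemma computes_edge u v : computes m u -> computes m v ->
  computes m (fun a => edge (M a) (u a) (v a)).
Proof. by move=> Hu Hv; rewrite /edge; computing. Qed.

Lemma computes_vertices : computes m (fun a => vertices (M a)).
Proof. by rewrite /vertices; computing. Qed.
End Poly.

Ltac computes_user ::= first [apply: computes_edge | apply: computes_vertices].

Section Poly.
Context {A : Type} {EA : Enc A}.
Variables (m : A -> nat) (M : A -> seq (seq bool)).
Hypothesis HM : computes m M.

Lemma computes_grow S R : computes m S -> computes m R ->
  computes m (fun a => grow (M a) (S a) (R a)).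
Proof. by move=> HS HR; rewrite /grow; computing. Qed.

Lemma computes_nbrs S : computes m S -> computes m (fun a => nbrs (M a) (S a)).
Proof. by move=> HS; rewrite /nbrs; computing. Qed.

Lemma computes_minus (S X : A -> seq nat) : computes m S -> computes m X ->
  computes m (fun a => minus (S a) (X a)).
Proof. by move=> HS HX; rewrite /minus; computing. Qed.
End Poly.

Ltac computes_user ::= first [apply: computes_edge | apply: computes_vertices
  | apply: computes_grow | apply: computes_nbrs | apply: computes_minus].

Section Poly.
Context {A : Type} {EA : Enc A}.
Variables (m : A -> nat) (M : A -> seq (seq bool)).
Hypothesis HM : computes m M.

Lemma computes_ball S i u : computes m S -> computes m i -> computes m u ->
  computes m (fun a => ball (M a) (S a) (i a) (u a)).
Proof.
move=> HS Hi Hu; rewrite /ball.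
apply: (computes_iter (m' := fun x => m x.1)); [by []|by computing..| |].
  exists (fun a => esize (S a)); first exact: computes_esize.
  by move=> a [|j] _; rewrite ?iterS; apply: esize_subseq.
by exists m; first exact: pbound_id.
Qed.
End Poly.

Ltac computes_user ::= first [apply: computes_edge | apply: computes_vertices
  | apply: computes_grow | apply: computes_nbrs | apply: computes_minus
  | apply: computes_ball].

Section Poly.
Context {A : Type} {EA : Enc A}.
Variables (m : A -> nat) (M : A -> seq (seq bool)).
Hypothesis HM : computes m M.

Lemma computes_comp_of S u : computes m S -> computes m u ->
  computes m (fun a => comp (M a) (S a) (u a)).
Proof. by move=> HS Hu; rewrite /comp; computing. Qed.

Lemma computes_near i u v : computes m i -> computes m u -> computes m v ->
  computes m (fun a => near (M a) (i a) (u a) (v a)).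
Proof. by move=> Hi Hu Hv; rewrite /near; computing. Qed.
End Poly.

Ltac computes_user ::= first [apply: computes_edge | apply: computes_vertices
  | apply: computes_grow | apply: computes_nbrs | apply: computes_minus
  | apply: computes_ball | apply: computes_comp_of | apply: computes_near].

Section Poly.
Context {A : Type} {EA : Enc A}.
Variables (m : A -> nat) (M : A -> seq (seq bool)).
Hypothesis HM : computes m M.

Lemma computes_stable i : computes m i -> computes m (fun a => stable (M a) (i a)).
Proof. by move=> Hi; rewrite /stable; computing. Qed.

Lemma computes_unbalanced W T : computes m W -> computes m T ->
  computes m (fun a => unbalanced (M a) (W a) (T a)).
Proof. by move=> HW HT; rewrite /unbalanced; computing. Qed.

Lemma computes_cdist r u v : computes m r -> computes m u -> computes m v ->
  computes m (fun a => cdist (M a) (r a) (u a) (v a)).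
Proof. by move=> Hr Hu Hv; rewrite /cdist; computing. Qed.

Lemma computes_mins r l : computes m r -> computes m l ->
  computes m (fun a => mins (r a) (l a)).
Proof.
move=> Hr Hl; rewrite /mins; apply: computes_fold => //; first by computing.
exists (fun a => esize (r a)); first exact: computes_esize.
move=> a l1 _ _; rewrite !esize_nat ltnS leq_double.
by elim: l1 (r a) => //= x l1 IH s; apply: leq_trans (IH _) (geq_minl _ _).
Qed.
End Poly.

Ltac computes_user ::= first [apply: computes_edge | apply: computes_vertices
  | apply: computes_grow | apply: computes_nbrs | apply: computes_minus
  | apply: computes_ball | apply: computes_comp_of | apply: computes_near
  | apply: computes_stable | apply: computes_unbalanced | apply: computes_cdist
  | apply: computes_mins].

Section Poly.
Context {A : Type} {EA : Enc A}.
Variables (m : A -> nat) (M : A -> seq (seq bool)).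
Hypothesis HM : computes m M.

Lemma computes_cap d : computes m d -> computes m (fun a => cap (M a) (d a)).
Proof. by move=> Hd; rewrite /cap; computing. Qed.

Lemma computes_min_unbalanced W S : computes m W -> computes m S ->
  computes m (fun a => min_unbalanced (M a) (W a) (S a)).
Proof.
move=> HW HS; rewrite /min_unbalanced; apply: computes_fold => //; first by computing.
exists (fun a => esize (S a)); first exact: computes_esize.
move=> a l1 _ _; elim/last_ind: l1 => // l1 x IH; rewrite foldl_rcons.
by case: ifP => // _; apply: leq_trans (esize_subseq _ _ _) IH.
Qed.

Lemma computes_balances W S X : computes m W -> computes m S -> computes m X ->
  computes m (fun a => balances (M a) (W a) (S a) (X a)).
Proof. by move=> HW HS HX; rewrite /balances; computing. Qed.

Lemma computes_profile r B K : computes m r -> computes m B -> computes m K ->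
  computes m (fun a => profile (M a) (r a) (B a) (K a)).
Proof. by move=> Hr HB HK; rewrite /profile; computing. Qed.

Lemma computes_mask B f : computes m B -> computes m f ->
  computes m (fun a => mask (M a) (B a) (f a)).
Proof. by move=> HB Hf; rewrite /mask; computing. Qed.

Lemma computes_compatible r f h B : computes m r -> computes m f -> computes m h ->
  computes m B -> computes m (fun a => compatible (r a) (f a) (h a) (B a)).
Proof. by move=> Hr Hf Hh HB; rewrite /compatible; computing. Qed.

Lemma computes_combine r B' f h B : computes m r -> computes m B' -> computes m f ->
  computes m h -> computes m B ->
  computes m (fun a => combine (M a) (r a) (B' a) (f a) (h a) (B a)).
Proof. by move=> Hr HB' Hf Hh HB; rewrite /combine; computing. Qed.

Lemma computes_dedup l : computes m l -> computes m (fun a => dedup (l a)).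
Proof.
move=> Hl; rewrite /dedup; apply: computes_fold => //; first by computing.
  apply: computes_if; [|by computing..].
  apply: computes_mem; last by computing.
  apply: (computes_eq (F := fun x : A * seq (seq nat * nat) * (seq nat * nat) * (seq nat * nat) =>
    (x.2.1 == x.1.2.1) && (x.2.2 == x.1.2.2))).
    by move=> [[[a s] [f k]] [f' k']].
  by computing.
exists (fun a => esize (l a)); first exact: computes_esize.
move=> a l1 l2 ->.
apply: (@leq_trans (esize l1)); last first.
  by rewrite -ltnS esize_cat -[X in X < _]addn0 ltn_add2l esize_gt0.
elim/last_ind: l1 => // l1 x IH; rewrite foldl_rcons esize_rcons.
case: ifP => _; last by rewrite esize_cons ltnS leq_add2l.
  exact: leq_trans IH (leqW (leq_addl _ _)).
Qed.

Lemma computes_inside (ps : A -> seq piece) v : computes m ps -> computes m v ->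
  computes m (fun a => inside (ps a) (v a)).
Proof. by move=> Hps Hv; rewrite /inside; computing. Qed.

Lemma computes_outside (ps : A -> seq piece) v : computes m ps -> computes m v ->
  computes m (fun a => outside (ps a) (v a)).
Proof. by move=> Hps Hv; rewrite /outside; computing. Qed.
End Poly.

Ltac computes_user ::= first [apply: computes_edge | apply: computes_vertices
  | apply: computes_grow | apply: computes_nbrs | apply: computes_minus
  | apply: computes_ball | apply: computes_comp_of | apply: computes_near
  | apply: computes_stable | apply: computes_unbalanced | apply: computes_cdist
  | apply: computes_mins | apply: computes_cap | apply: computes_min_unbalanced
  | apply: computes_balances | apply: computes_profile | apply: computes_mask
  | apply: computes_compatible | apply: computes_combine | apply: computes_dedup
  | apply: computes_inside | apply: computes_outside].

Section Poly.
Context {A : Type} {EA : Enc A}.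
Variables (m : A -> nat) (M : A -> seq (seq bool)).
Hypothesis HM : computes m M.

Lemma computes_separator_step W S L : computes m W -> computes m S -> computes m L ->
  computes m (fun a => separator_step (M a) (W a) (S a) (L a)).
Proof. by move=> HW HS HL; rewrite /separator_step /expand; computing. Qed.

Lemma computes_merge r B' T p : computes m r -> computes m B' -> computes m T ->
  computes m p -> computes m (fun a => merge (M a) (r a) (B' a) (T a) (p a : piece)).
Proof. by move=> Hr HB' HT Hp; rewrite /merge; computing. Qed.

Lemma computes_leaf r B v : computes m r -> computes m B -> computes m v ->
  computes m (fun a => leaf (M a) (r a) (B a) (v a)).
Proof. by move=> Hr HB Hv; rewrite /leaf; computing. Qed.

Lemma computes_joined (ps : A -> seq piece) v : computes m ps -> computes m v ->
  computes m (fun a => joined (ps a) (v a)).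
Proof. by move=> Hps Hv; rewrite /joined; computing. Qed.

Lemma computes_read_int c z : computes m c -> computes m z ->
  computes m (fun a => read_int (c a) (z a)).
Proof.
move=> Hc Hz; rewrite /read_int /read_nat; apply: computes_if; [by computing..|].
apply: computes_fold; [by computing..|].
exists (fun a => esize (c a)); first exact: computes_esize.
move=> a l1 _ _; rewrite !esize_nat ltnS leq_double.
by elim/last_ind: l1 => // l1 x _; rewrite foldl_rcons geq_minl.
Qed.
End Poly.

(** * Running time *)

Definition instance := (graph * int * int)%type.

#[global] Instance enc_of_instance : Enc instance :=
  fun I => enc_instance I.1.1 I.1.2 I.2.

Definition td_scale (I : instance) := 2 ^ (treedepth I.1.1 ^ 2).

Definition mat (I : instance) := matrix I.1.1.

Lemma computes_raw m : computes m
  (fun I : instance => (mat I, (code_int I.1.2, code_int I.2))).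
Proof.
apply: computes_cast (computes_id m) => -[[G d] k].
rewrite /enc /enc_of_instance /enc_of_pair /enc_instance /enc_graph /=; congr Defs.Cons.
rewrite /mat /matrix /enc /enc_of_seq -map_comp; congr enc_list; apply: eq_map => i /=.
by rewrite /enc /enc_of_seq -map_comp.
Qed.

Lemma computes_mat m : computes m mat.
Proof. exact: (computes_fst (computes_raw m)). Qed.

Lemma computes_instance_d m : computes m (fun I : instance => code_int I.1.2).
Proof. exact: (computes_fst (computes_snd (computes_raw m))). Qed.

Lemma computes_instance_k m : computes m (fun I : instance => code_int I.2).
Proof. exact: (computes_snd (computes_snd (computes_raw m))). Qed.

Lemma esize_seq_mem (T : eqType) (ET : Enc T) (s : seq T) k :
  (forall x, x \in s -> esize x <= k) -> esize s <= (size s * k.+1).+1.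
Proof.
by move=> H; apply: esize_seq_le => l1 x l2 E; apply: H; rewrite E mem_cat mem_head orbT.
Qed.

Lemma esize_vertex_seq (M : seq (seq bool)) (X : seq nat) :
  uniq X -> {subset X <= vertices M} -> esize X <= (size M * (size M).*2.+2).+1.
Proof.
move=> uX XV; have sX : size X <= size M.
  by rewrite -[size M](size_iota 0); apply: uniq_leq_size.
apply: leq_trans (esize_seq_mem (k := (size M).*2.+1) _) _; last by rewrite ltnS leq_mul2r sX orbT.
move=> x /XV; rewrite mem_vertices esize_nat; lia.
Qed.

Section Separators.
Context {A : Type} {EA : Enc A}.
Variables (m : A -> nat) (M : A -> seq (seq bool)) (W S : A -> seq nat).
Hypotheses (HM : computes m M) (HW : computes m W) (HS : computes m S).

(** The size of the candidate lists is not polynomial in the arguments, so its bound remains a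
    hypothesis. *)
Lemma computes_separator :
  (exists2 b, pbound m b & forall a i, i <= size (M a) ->
     esize (iter i (separator_step (M a) (W a) (S a)) [:: [::]]) <= b a) ->
  computes m (fun a => separator (M a) (W a) (S a)).
Proof.
move=> Hb; rewrite /separator /separators; apply: computes_head; first exact: computes_const.
apply: computes_filter.
  by computing.
apply: (computes_iter (m' := fun x => m x.1)) => //.
- exact: computes_size.
- by apply: computes_separator_step; computing.
- exact: computes_const.
- by exists m; first exact: pbound_id.
Qed.
End Separators.

(** When no vertex is left the default 0 lies outside the empty set, and the component is empty. *)
Definition next_comp (M : seq (seq bool)) X :=
  comp M (minus (vertices M) X) (head 0 (minus (vertices M) X)).

Definition separators_at (M : seq (seq bool)) X i :=
  iter i (separator_step M (nbrs M (next_comp M X)) (next_comp M X ++ nbrs M (next_comp M X)))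
    [:: [::]].

(** All intermediate candidate lists are charged to the argument, which makes a round polynomial for
    every [X]. For the [X] of the actual run the width bounds the sum. *)
Definition extend_cost (x : instance * seq nat) :=
  td_scale x.1 + \sum_(i < (size (mat x.1)).+1) esize (separators_at (mat x.1) x.2 i).

Lemma computes_extend : computes extend_cost (fun x => extend (mat x.1) x.2).
Proof.
have HM : computes extend_cost (fun x => mat x.1).
  apply: (computes_comp (computes_mat (fun=> 0)) (computes_fst (computes_id _))).
  exact: pbound_const.
have HC : computes extend_cost (fun x => next_comp (mat x.1) x.2).
  by rewrite /next_comp; computing.
have HS : computes extend_cost (fun x => separator (mat x.1) (nbrs (mat x.1) (next_comp (mat x.1) x.2))
    (next_comp (mat x.1) x.2 ++ nbrs (mat x.1) (next_comp (mat x.1) x.2))).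
  apply: computes_separator => //; [by computing..|].
  exists extend_cost; first exact: pbound_id.
  move=> x i le; have lt : i < (size (mat x.1)).+1 by [].
  by rewrite /extend_cost (bigD1 (Ordinal lt)) //= addnCA; apply: leq_addr.
apply: (computes_eq (F := fun x => if size (minus (vertices (mat x.1)) x.2) == 0 then x.2 else
  next_vertices (mat x.1) x.2 (head 0 (minus (vertices (mat x.1)) x.2)) ++ x.2)).
  by move=> x; rewrite /extend; case: minus.
by rewrite /next_vertices; computing.
Qed.

(** * Sizes of the values that occur along the run *)

Section Bounds.
Variable I : instance.
Local Notation G := (I.1.1).
Local Notation M := (mat I).
Local Notation n := (size (mat I)).
Local Notation h := (treedepth I.1.1).

Let M_sym := @matrix_sym G.
Let M_bound := @matrix_bound G.

Lemma separators_bound X i : width_le M X h.*2.+2 ->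
  esize (separators_at M X i) <=
    ((h.*2.+2 * 2 ^ h) ^ h * (n * n.*2.+2).+2).+1.
Proof.
move=> wX; have [anc [dep [a1 a2 a3 a4 [a5 a6 a7]]]] := treedepth_order G.
set C := next_comp M X.
have CV : {subset C <= vertices M} by move=> x /comp_sub; rewrite mem_minus => /andP[].
have CWV : {subset C ++ nbrs M C <= vertices M}.
  by move=> x; rewrite mem_cat => /orP[/CV|/nbrs_sub].
have CWu : uniq (C ++ nbrs M C).
  rewrite cat_uniq comp_uniq ?nbrs_uniq ?andbT /=; last exact/minus_uniq/iota_uniq.
  by apply/hasPn => x /(nbrsP M_sym M_bound)[].
have Wh : size (nbrs M C) <= h.*2.+2.
  case E: (minus (vertices M) X) => [|u s].
    suff -> : nbrs M C = [::] by [].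
    case EN: (nbrs M C) => [|y t] //.
    have : y \in nbrs M C by rewrite EN mem_head.
    by case/(nbrsP M_sym M_bound) => _ [c]; rewrite /C /next_comp E.
  by apply: wX; rewrite E mem_head.
have [s [sh LX sL _]] := separators_inv M_sym M_bound a1 a2 a3 a4 a5 a6 a7 (nbrs M C) i CWu CWV.
rewrite /separators_at -/C; set L := iter _ _ _ in LX sL *.
apply: leq_trans (esize_seq_mem (k := (n * n.*2.+2).+1) _) _.
  by move=> Y /LX[_ uY YV]; apply: esize_vertex_seq => // x /YV /CWV.
rewrite ltnS leq_mul2r /=; apply: leq_trans sL _.
apply: (@leq_trans ((h.*2.+2 * 2 ^ h) ^ s)).
  by case: (s) => // s'; rewrite leq_exp2r // leq_mul2r Wh orbT.
by rewrite leq_pexp2l // muln_gt0 expn_gt0.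
Qed.

Lemma cap_bounds d : cap M d <= 2 ^ h /\ cap M d <= n.+1.
Proof.
have [anc [dep [a1 a2 a3 a4 [a5 a6 a7]]]] := treedepth_order G.
split; first exact: (cap_bound M_sym M_bound a1 a2 a3 a4 a5 a6 a7).
apply: leq_trans (find_size _ _) _; rewrite size_iota; exact: geq_minr.
Qed.

(** Profiles on [3h + 4] boundary vertices, with [2 ^ h + 1] rounded up to [2 ^ h.+1], times the
    possible set sizes, times the encoding of one entry. *)
Definition table_bound := ((2 ^ h.+1) ^ (3 * h + 4) * n.+1 * (n * n.*2 * 4 + n * 20 + 20)).+1.

Lemma table_esize d C B T : exact M (cap M d) C B T -> uniq T ->
  {subset C <= vertices M} -> size B <= 3 * h + 4 -> esize T <= table_bound.
Proof.
move=> ex uT CV sB; have [rh rn] := cap_bounds d.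
apply: leq_trans (esize_seq_mem (k := n * n.*2 * 4 + n * 20 + 19) _) _.
  move=> [f s] /ex[K [uK KC _ -> ->]]; rewrite esize_pair esize_nat.
  have sK : size K <= n.
    by rewrite -[n](size_iota 0); apply: uniq_leq_size => // x /KC /CV.
  have : esize (profile M (cap M d) B K) <= (n * (n.+1).*2.+2).+1.
    apply: leq_trans (esize_seq_mem (k := (n.+1).*2.+1) _) _.
      move=> y /mapP[x _ ->]; rewrite esize_nat ltnS leq_double.
      by case: ifP => // _; apply: leq_trans (mins_le _ _) rn.
    by rewrite size_map size_iota.
  move=> hp; move: (esize _) (size K) (size (mat I)) hp sK => e k N hp sK.
  have : N * N.*2 = N * N + N * N by lia.
  by nia.
rewrite ltnS; apply: leq_mul; last by lia.
apply: leq_trans (table_size ex uT CV) _; rewrite leq_mul2r /=.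
apply: (@leq_trans ((2 ^ h.+1) ^ size B)).
  case: (size B) => // b; rewrite leq_exp2r //.
  by have := ltn_expl h (ltnSn 1); rewrite expnS; lia.
by rewrite leq_pexp2l ?expn_gt0.
Qed.

Lemma pieces_split r l1 l2 : elimination_order M = l1 ++ l2 ->
  pieces_ok M r (rev l1) (foldl (eliminate M r) [::] l1).
Proof.
move=> E; have := elimination_order_ok M_sym M_bound r (size l1).
by rewrite E take_size_cat.
Qed.

Lemma pieces_nbrs_split r l1 l2 p : elimination_order M = l1 ++ l2 ->
  p \in foldl (eliminate M r) [::] l1 -> size (nbrs M p.1.1) <= 3 * h + 3.
Proof.
have [anc [dep [a1 a2 a3 a4 [a5 a6 a7]]]] := treedepth_order G.
move=> E pps; apply: (piece_nbrs_size M_sym M_bound a1 a2 a3 a4 a5 a6 a7 (r := r) (i := size l1)).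
by rewrite E take_size_cat.
Qed.

Lemma order_sub l1 l2 : elimination_order M = l1 ++ l2 -> {subset l1 <= vertices M}.
Proof. by move=> E x xl; rewrite -mem_elimination_order E mem_cat xl. Qed.

Lemma pieces_uniq r l : forall p, p \in foldl (eliminate M r) [::] l -> uniq p.2.
Proof.
elim/last_ind: l => [|l v IH] p //; rewrite foldl_rcons inE => /predU1P[->|].
  exact: dedup_uniq.
by rewrite mem_filter => /andP[_ /IH].
Qed.

Lemma size_pieces r l : size (foldl (eliminate M r) [::] l) <= size l.
Proof.
elim/last_ind: l => [|l v IH] //; rewrite foldl_rcons size_rcons /= ltnS.
by apply: leq_trans IH; rewrite size_filter count_size.
Qed.

Definition pieces_bound := (n * (table_bound + (n * n.*2.+2).*2 + 9)).+1.

Lemma pieces_esize d l1 l2 : elimination_order M = l1 ++ l2 ->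
  esize (foldl (eliminate M (cap M d)) [::] l1) <= pieces_bound.
Proof.
move=> E; have [ok uF eqU] := pieces_split (cap M d) E.
have l1V := order_sub E.
have sl : size l1 <= n.
  rewrite -[n](size_iota 0); apply: uniq_leq_size => //.
  by have := elimination_order_uniq M; rewrite E cat_uniq => /andP[].
apply: leq_trans (esize_seq_mem (k := table_bound + (n * n.*2.+2).*2 + 8) _) _; last first.
  rewrite ltnS /pieces_bound; apply: leq_mul; first exact: leq_trans (size_pieces _ _) sl.
  by lia.
move=> p pps; have [Ep ex sub nU cn] := ok p pps.
have CV : {subset p.1.1 <= vertices M} by move=> x /sub; rewrite mem_rev => /l1V.
have uC : uniq p.1.1.
  case/splitPr: pps uF => p1 p2; rewrite map_cat flatten_cat cat_uniq /= cat_uniq.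
  by case/and3P=> _ _ /and3P[].
have := pieces_nbrs_split E pps; rewrite -Ep => sB.
have hT : esize p.2 <= table_bound.
  by apply: (table_esize ex) => //; [exact: pieces_uniq pps|lia].
have hC : esize p.1.1 <= (n * n.*2.+2).+1 by apply: esize_vertex_seq.
have hB : esize p.1.2 <= (n * n.*2.+2).+1.
  by rewrite Ep; apply: esize_vertex_seq; [exact: nbrs_uniq|exact: nbrs_sub].
case: p hT hC hB {ok uF eqU pps Ep ex sub nU cn CV uC sB} => -[C B] T /= hT hC hB.
rewrite !esize_pair.
by move: hT hC hB; move: (esize C) (esize B) (esize T) => x y z; lia.
Qed.

Lemma uniq_merges r B' T0 ps : uniq T0 -> uniq (foldl (merge M r B') T0 ps).
Proof.
by case/lastP: ps => // ps p; rewrite foldl_rcons => _; apply: dedup_uniq.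
Qed.

Lemma joined_esize d l1 v l2 k1 k2 (ps := foldl (eliminate M (cap M d)) [::] l1) :
  elimination_order M = l1 ++ v :: l2 -> inside ps v = k1 ++ k2 ->
  esize (foldl (merge M (cap M d) (v :: nbrs M (joined ps v)))
    (leaf M (cap M d) (v :: nbrs M (joined ps v)) v) k1) <= table_bound.
Proof.
move=> E Ek; have ok := pieces_split (cap M d) E.
have vl1 : v \notin rev l1.
  rewrite mem_rev; have := elimination_order_uniq M; rewrite E cat_uniq => /and3P[_ /hasPn h _].
  by apply: (h v); rewrite mem_head.
have ex := exact_joined M_sym M_bound ok vl1 Ek.
apply: (table_esize ex).
- by apply: uniq_merges; rewrite /leaf /= inE andbT; apply/eqP => -[].
- have l1V := order_sub E.
  have vV : v \in vertices M by rewrite -mem_elimination_order E mem_cat mem_head orbT.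
  move=> x; rewrite inE => /predU1P[->//|/flattenP[C /mapP[p pk ->] xp]].
  have : p \in inside ps v by rewrite Ek mem_cat pk.
  rewrite mem_filter => /andP[_ pps]; case: ok => /(_ p pps)[_ _ sub _ _] _ _.
  by apply: l1V; rewrite -mem_rev; apply: sub.
(* The joined set becomes the head piece once [v] is eliminated, so its neighbourhood obeys the
   width bound; [v] itself accounts for [3h + 4]. *)
- have E' : elimination_order M = rcons l1 v ++ l2 by rewrite cat_rcons.
  have := pieces_nbrs_split (r := cap M d) E'; rewrite foldl_rcons.
  move=> /(_ (joined ps v, _, _) (mem_head _ _)) /= le.
  by rewrite [size _]/= addnS ltnS.
Qed.

Lemma final_esize d l1 l2 : pieces M (cap M d) = l1 ++ l2 ->
  esize (foldl (merge M (cap M d) [::]) [:: (profile M (cap M d) [::] [::], 0)] l1) <= table_bound.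
Proof.
move=> E; have ok := pieces_ok_final M_sym M_bound (cap M d).
have ex := exact_final M_sym M_bound ok E.
apply: (table_esize ex) => //; first exact: uniq_merges.
move=> x /flattenP[C /mapP[p pk ->] xp]; case: ok => + _ _.
have pps : p \in pieces M (cap M d) by rewrite E mem_cat pk.
by move=> /(_ p pps)[_ _ sub _ _]; apply: sub.
Qed.

End Bounds.

(** * Polynomial bounds relative to [td_scale], and the complete program *)

Lemma pbound_size_mat : pbound td_scale (fun I => size (mat I)).
Proof.
apply: pbound_le (computes_esize (computes_mat _)) => I; exact: ltnW (size_esize _ _).
Qed.

Lemma pbound_double A (EA : Enc A) (m b : A -> nat) :
  pbound m b -> pbound m (fun a => (b a).*2).
Proof.
move=> H; apply: (pbound_le (b2 := fun a => b a + b a)) => [a|]; first by rewrite addnn.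
exact: pbound_add.
Qed.

Lemma pbound_exp_td c : pbound td_scale (fun I => 2 ^ (c * treedepth I.1.1 ^ 2)).
Proof.
apply: (pbound_le (b2 := fun I => td_scale I ^ c)).
  by move=> I; rewrite /td_scale -expnM mulnC.
exact/pbound_exp/pbound_id.
Qed.

Ltac pbounding := do ![apply: pbound_add | apply: pbound_mul | apply: pbound_succ
  | apply: pbound_double | exact: pbound_size_mat | exact: pbound_const | done].

Lemma pbound_separators : pbound td_scale (fun I =>
  ((((treedepth I.1.1).*2.+2 * 2 ^ treedepth I.1.1) ^ treedepth I.1.1)
    * (size (mat I) * (size (mat I)).*2.+2).+2).+1).
Proof.
apply: pbound_succ; apply: pbound_mul; last by pbounding.
(* Since [2h + 2] is at most [2 ^ (h + 1)], the exponent is at most [(2h + 1) h], hence at most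
   [3 h ^ 2]. *)
apply: pbound_le (pbound_exp_td 3) => I; set h := treedepth _.
apply: (@leq_trans ((2 ^ h.+1 * 2 ^ h) ^ h)).
  case: (posnP h) => [->//|h0]; rewrite leq_exp2r // leq_mul2r -doubleS expnS mul2n leq_double.
  by rewrite ltn_expl ?orbT.
by rewrite -expnD -expnM leq_exp2l //; nia.
Qed.

Lemma pbound_table : pbound td_scale table_bound.
Proof.
rewrite /table_bound; pbounding.
(* The exponent [(h + 1) (3h + 4)] equals [3 h ^ 2 + 7h + 4], and [h] is at most [h ^ 2]. *)
apply: (pbound_le (b2 := fun I => 2 ^ (10 * treedepth I.1.1 ^ 2) * 2 ^ 4)).
  by move=> I; rewrite -expnD -expnM leq_exp2l //; nia.
by apply: pbound_mul (pbound_const _ _); apply: pbound_exp_td.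
Qed.

Lemma pbound_pieces : pbound td_scale pieces_bound.
Proof.
apply: pbound_succ; apply: pbound_mul; first exact: pbound_size_mat.
by apply: pbound_add (pbound_const _ _); apply: pbound_add pbound_table _; pbounding.
Qed.

Lemma computes_elimination_order : computes td_scale (fun I => elimination_order (mat I)).
Proof.
rewrite /elimination_order; apply: (computes_iter (m' := extend_cost)).
- exact/computes_size/computes_mat.
- exact: computes_extend.
- exact: computes_const.
- exists (fun I => (size (mat I) * (size (mat I)).*2.+2).+1); first by pbounding.
  move=> I i _; have [u s _] := iter_extend_ok (mat I) i.
  exact: esize_vertex_seq.
exists (fun I => td_scale I + (size (mat I)).+1 *
  ((((treedepth I.1.1).*2.+2 * 2 ^ treedepth I.1.1) ^ treedepth I.1.1)
    * (size (mat I) * (size (mat I)).*2.+2).+2).+1).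
  apply: pbound_add; first exact: pbound_id.
  by apply: pbound_mul pbound_separators; pbounding.
move=> I i _; rewrite /extend_cost leq_add2l.
rewrite -[X in _ <= X * _]card_ord -sum_nat_const; apply: leq_sum => j _ /=.
apply: separators_bound.
have [anc [dep [a1 a2 a3 a4 [a5 a6 a7]]]] := treedepth_order I.1.1.
by have [] := width_iter (@matrix_sym _) (@matrix_bound _) a1 a2 a3 a4 a5 a6 a7 i.
Qed.

Definition distance_cap (I : instance) :=
  cap (mat I) (read_int (size (mat I)).+1 (code_int I.1.2)).

Lemma computes_distance_cap m : computes m distance_cap.
Proof.
have HM := computes_mat m; have Hd := computes_instance_d m.
by rewrite /distance_cap; apply: computes_cap => //; apply: computes_read_int; computing.
Qed.

(** As in [extend_cost], here for the tables obtained after merging each prefix of the adjacent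
    pieces. *)
Definition eliminate_cost (x : instance * seq piece * nat) :=
  td_scale x.1.1 + \sum_(i < (size (inside x.1.2 x.2)).+1)
    esize (foldl (merge (mat x.1.1) (distance_cap x.1.1)
                    (x.2 :: nbrs (mat x.1.1) (joined x.1.2 x.2)))
      (leaf (mat x.1.1) (distance_cap x.1.1)
         (x.2 :: nbrs (mat x.1.1) (joined x.1.2 x.2)) x.2)
      (take i (inside x.1.2 x.2))).

Lemma computes_eliminate : computes eliminate_cost
  (fun x => eliminate (mat x.1.1) (distance_cap x.1.1) x.1.2 x.2).
Proof.
have H11 : computes eliminate_cost (fun x => x.1.1) by computing.
have HM : computes eliminate_cost (fun x => mat x.1.1).
  exact: (computes_comp (computes_mat (fun=> 0)) H11 (pbound_const _ _)).
have Hr : computes eliminate_cost (fun x => distance_cap x.1.1).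
  exact: (computes_comp (computes_distance_cap (fun=> 0)) H11 (pbound_const _ _)).
have HJ : computes eliminate_cost (fun x => joined x.1.2 x.2).
  by apply: computes_joined; computing.
have HN : computes eliminate_cost (fun x => nbrs (mat x.1.1) (joined x.1.2 x.2)).
  by computing.
have HT : computes eliminate_cost
    (fun x => joined_table (mat x.1.1) (distance_cap x.1.1) x.1.2 x.2).
  rewrite /joined_table; apply: computes_fold.
  - by computing.
  - by cbv beta; apply: computes_leaf; computing.
  - by cbv beta; apply: computes_merge; computing.
  exists eliminate_cost; first exact: pbound_id.
  move=> x l1 l2 E; have lt : size l1 < (size (inside x.1.2 x.2)).+1.
    by rewrite ltnS E size_cat leq_addr.
  have {1}-> : l1 = take (size l1) (inside x.1.2 x.2) by rewrite E take_size_cat.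
  by rewrite /eliminate_cost (bigD1 (Ordinal lt)) //= addnCA; apply: leq_addr.
rewrite /eliminate; apply: computes_cons; last by computing.
apply: computes_pair; first by computing.
by apply: computes_dedup; computing.
Qed.

Lemma computes_pieces : computes td_scale (fun I => pieces (mat I) (distance_cap I)).
Proof.
rewrite /pieces; apply: (computes_foldl (m' := eliminate_cost)).
- exact: computes_elimination_order.
- exact: computes_const.
- exact: computes_eliminate.
- exists pieces_bound; first exact: pbound_pieces.
  by move=> I l1 l2 E; apply: pieces_esize E.
exists (fun I => td_scale I + (size (mat I)).+1 * table_bound I).
  apply: pbound_add; first exact: pbound_id.
  by apply: pbound_mul pbound_table; pbounding.
move=> I l1 v l2 E; rewrite /eliminate_cost leq_add2l /=.
set ps := foldl _ _ _.
apply: (@leq_trans ((size (inside ps v)).+1 * table_bound I)).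
  rewrite -[X in _ <= X * _]card_ord -sum_nat_const; apply: leq_sum => j _ /=.
  exact: (joined_esize E (esym (cat_take_drop j _))).
rewrite leq_mul2r ltnS; apply/orP; right.
have sl : size l1 <= size (mat I).
  have := uniq_leq_size (elimination_order_uniq (mat I)) (s2 := vertices (mat I)).
  rewrite E size_cat /= size_iota => /(_ _) le; apply: leq_trans (leq_addr _ _) (le _).
  by move=> x; rewrite -E mem_elimination_order.
by apply: leq_trans sl; rewrite size_filter; apply: leq_trans (count_size _ _) (size_pieces _ _ _).
Qed.

Lemma computes_solve : computes td_scale
  (fun I : instance => solve (mat I) (code_int I.1.2) (code_int I.2)).
Proof.
have HM := computes_mat td_scale; have Hr := computes_distance_cap td_scale.
have HP := computes_pieces; have Hk := computes_instance_k td_scale.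
have HK : computes td_scale (fun I : instance => read_int (size (mat I)).+1 (code_int I.2)).
  by apply: computes_read_int; computing.
have HF : computes td_scale (fun I : instance => final_table (mat I) (distance_cap I)).
  rewrite /final_table; apply: computes_fold.
  - exact: HP.
  - by computing.
  - by cbv beta; apply: computes_merge; computing.
  exists table_bound; first exact: pbound_table.
  by move=> I l1 l2 E; apply: final_esize E.
rewrite /solve /answer; by computing.
Qed.

Theorem theorem5 :
  exists (P : program) (a b c : nat),
  forall (G : graph) (d k : int),
  exists time : nat,
    runs P (enc_instance G d k) (enc_bool (has_scattered_set G d k)) time /\
    time <= a * tree_size (enc_instance G d k) ^ b * 2 ^ (c * treedepth G ^ 2).
Proof.
have [T [c HT] H] := computes_solve.
(* Function 0 is the entry point, so the auxiliary functions start at position 1. *)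
have [Q [e He]] := H 1.
(* For positive [x] and [y] the sum [x + y + 1] is at most [3 x y]; this separates the input size
   from the tree-depth factor inside the power [c]. *)
exists (e :: Q), (3 ^ c), c, c => G d k.
have [|t [E L _]] := He (e :: Q) [::] (G, d, k); first by [].
exists t; split; first by move: E; rewrite -solveE.
apply: leq_trans L _; apply: leq_trans (HT _) _.
rewrite -[c * _]mulnC expnM -!expnMn; case: c {HT} => // c.
rewrite leq_exp2r //; rewrite /scale /td_scale.
have s0 := esize_gt0 enc_of_instance (G, d, k).
have -> : tree_size (enc_instance G d k) = esize (G, d, k) by [].
have : 0 < 2 ^ treedepth G ^ 2 by rewrite expn_gt0.
move: (2 ^ _) (esize _) s0 => /= x y y0 x0; nia.
Qed.
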